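(* Let $\ell\in\mathbb N^*$. Let $\mathbf p$ be an offspring distribution with $\mathbf p(0)+\mathbf p(1)<1$, with finite mean, and admitting a moment of order $\ell$, and let $\mathbf q$ be a mark function such that $\mathbf p(k)\mathbf q(k)>0$ for some $k\in\mathbb N$. Let $\mathbb P$ be the distribution of the marked Galton-Watson tree with offspring distribution $\mathbf p$ and mark function $\mathbf q$. Suppose that $\tilde r:=\min\{j\ge0:\mathbf p(j)(1-\mathbf q(j))>0\}$ satisfies $\tilde r\ge1$, and let $t\in(0,1]$. Then for all $n\in\mathbb N$ and $\Lambda_n\in\mathscr F_n$, $$\lim_{p\to+\infty}\frac{\mathbb E[\mathbf 1_{\Lambda_n}H_\ell(Z_{n+p})\mathbf 1_{M_{n+p}=0}t^{Z_{n+p}}]}{\mathbb E[H_\ell(Z_{n+p})\mathbf 1_{M_{n+p}=0}t^{Z_{n+p}}]}=\begin{cases}\mathbb E\left[\mathbf 1_{\Lambda_n}\mathbf p_0(1,0)^{-n}\mathbf 1_{M_n=0,\,Z_n=1}\right]&\text{if }\tilde r=1,\\ \mathbb E\left[\mathbf 1_{\Lambda_n}\mathbf p_0(\tilde r,0)^{-\frac{\tilde r^n-1}{\tilde r-1}}\mathbf 1_{M_n=0,\,Z_n=\tilde r^n}\right]&\text{if }\tilde r>1.\end{cases}$$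
   Context: $\mathbb N=\{0,1,2,\dots\}$, $\mathbb N^*=\{1,2,\dots\}$. Let $\mathscr U=\bigcup_{n\ge0}(\mathbb N^* )^n$ be the set of finite sequences of positive integers, $|u|$ the length of $u$, $\emptyset$ the empty sequence. A tree $\mathbf t$ is a subset of $\mathscr U$ such that $\emptyset\in\mathbf t$; $uj\in\mathbf t\Rightarrow u\in\mathbf t$ (for $j\in\mathbb N^*$); and for each $u\in\mathbf t$ there is $k_u(\mathbf t)\in\mathbb N$ with $ui\in\mathbf t\iff i\le k_u(\mathbf t)$. A marked tree is $\mathbf t^*=(\mathbf t,(\eta_u)_{u\in\mathbf t})$ with $\eta_u\in\{0,1\}$; $\mathbb T^*$ is the set of marked trees. For $n\in\mathbb N$, $r_n^*(\mathbf t^* )$ is the marked tree consisting of the nodes $u\in\mathbf t$ with $|u|\le n$, keeping the marks of nodes with $|u|\le n-1$ and setting the marks at level $n$ to $0$. $\mathscr F_n$ is the $\sigma$-field on $\mathbb T^*$ generated by $r_n^*$, and $\mathscr F=\bigvee_n\mathscr F_n$. $Z_n(\mathbf t^* )$ is the number of nodes $u\in\mathbf t$ with $|u|=n$; $M_0=0$ and $M_n(\mathbf t^* )=\sum_{u\in\mathbf t,|u|\le n-1}\eta_u$ for $n\ge1$. An offspring distribution is a probability distribution $\mathbf p$ on $\mathbb N$; a mark function is a map $\mathbf q:\mathbb N\to[0,1]$. Set $\mathbf p_0(k,1)=\mathbf p(k)\mathbf q(k)$, $\mathbf p_0(k,0)=\mathbf p(k)(1-\mathbf q(k))$. The marked Galton-Watson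 tree distribution $\mathbb P$ is the unique probability measure on $(\mathbb T^*,\mathscr F)$ such that, with $\tau^*$ the identity map of $\mathbb T^*$, for all $h\ge1$ and $\mathbf t^*\in\mathbb T^*$, $\mathbb P(r_h^*(\tau^* )=r_h^*(\mathbf t^* ))=\prod_{u\in\mathbf t,|u|\le h-1}\mathbf p_0(k_u(\mathbf t),\eta_u)$. $\mathbb E$ is the expectation under $\mathbb P$, and $Z_n=Z_n(\tau^* )$, $M_n=M_n(\tau^* )$. $H_\ell(x)=\frac1{\ell!}\prod_{j=0}^{\ell-1}(x-j)$ for $\ell\ge1$.
   Formalization: Added assumption: ℓ=1, or r̃>1, or p_0(k,0)>0 for some k≥2; otherwise Z_m=1 a.s. on {M_m=0}, so H_ℓ(Z_m)1_{M_m=0}=0 a.s. and the ratio is 0/0 for every index (e.g. p(1)=p(2)=1/2, q(1)=0, q(2)=1, ℓ=2). *)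

(* Defs.v *)
From HB Require Import structures.
From mathcomp Require Import all_boot all_order all_algebra finmap.
From mathcomp Require Import all_classical all_reals all_analysis.

Set Implicit Arguments.
Unset Strict Implicit.
Unset Printing Implicit Defensive.

Import Order.TTheory GRing.Theory Num.Theory.

Local Open Scope classical_set_scope.
Local Open Scope ring_scope.

(* Nodes are finite sequences of integers; [rcons u j] is the child u j of u.
   The last clause of [is_tree] forces child indices to be positive, so that
   every node of a tree is a finite sequence of positive integers. *)
Definition is_tree (t : set (seq nat)) : Prop :=
  [/\ t [::],
      forall u j, t (rcons u j) -> t u &
      forall u, t u -> exists k : nat,
        forall j, t (rcons u j) <-> (0 < j <= k)%N].

(* The marks (eta_u)_{u in t} are encoded by the set {u in t : eta_u = 1}. *)
Record marked_tree := MarkedTree {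
  nodes : set (seq nat);
  marked : set (seq nat);
  nodes_tree : is_tree nodes;
  marked_nodes : marked `<=` nodes
}.

Definition eta (t : marked_tree) (u : seq nat) : bool := `[< marked t u >].

(* For u in t, [is_tree] makes the set below a singleton; the default value 0 is
   only used when u is not in t. *)
Definition kids (t : marked_tree) (u : seq nat) : nat :=
  xget 0%N [set k | forall j, nodes t (rcons u j) <-> (0 < j <= k)%N].

Definition root_set : set (seq nat) := [set [::]].

Lemma root_set_tree : is_tree root_set.
Proof.
split=> //= [u j|u ->]; first by case: u.
by exists 0%N => j; split=> //; case: j.
Qed.

Definition root_tree : marked_tree :=
  MarkedTree root_set_tree (@sub0set _ root_set).

HB.instance Definition _ := gen_eqMixin marked_tree.
HB.instance Definition _ := gen_choiceMixin marked_tree.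
HB.instance Definition _ := isPointed.Build marked_tree root_tree.

Section restriction.
Variables (n : nat) (t : marked_tree).

Definition restr_nodes : set (seq nat) :=
  [set u | nodes t u /\ (size u <= n)%N].

Definition restr_marked : set (seq nat) :=
  [set u | marked t u /\ (size u < n)%N].

Lemma restr_nodes_tree : is_tree restr_nodes.
Proof.
have [t0 tp tk] := nodes_tree t; split.
- by split.
- move=> u j [/tp tu]; rewrite size_rcons => un; split=> //; exact: ltnW.
- move=> u [/tk[k uk] un]; case: (ltnP (size u) n) => [ltun|leun].
    exists k => j; rewrite -uk; split=> [[]//|tuj].
    by split; rewrite ?size_rcons.
  exists 0%N => j; split=> [[_]|]; first by rewrite size_rcons ltnNge leun.
  by case: j.
Qed.

Lemma restr_marked_nodes : restr_marked `<=` restr_nodes.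
Proof. by move=> u [/marked_nodes tu un]; split=> //; exact: ltnW. Qed.

Definition restr : marked_tree :=
  MarkedTree restr_nodes_tree restr_marked_nodes.

End restriction.

(* [restr n] takes countably many values, and its codomain carries the discrete
   sigma-field. *)
Definition tree_filtration (n : nat) : set_system marked_tree :=
  preimage_set_system setT (restr n) setT.

(* The measurable space of marked trees, whose sigma-field is the join of the
   sigma-fields [tree_filtration n]. *)
Notation tree_space := (g_sigma_algebraType (\bigcup_n tree_filtration n)).

Definition generation_size (n : nat) (t : marked_tree) : nat :=
  #|` fset_set [set u | nodes t u /\ size u = n]|%fset.

Definition mark_count (n : nat) (t : marked_tree) : nat :=
  \big[addn/0%N]_(u \in [set u | nodes t u /\ (size u < n)%N]) eta t u.

Section marked_galton_watson.
Context {R : realType}.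
Implicit Types p q : nat -> R.

Definition offspring_distribution p : Prop :=
  (forall k, 0 <= p k) /\ (\sum_(0 <= k <oo) (p k)%:E = 1)%E.

Definition finite_moment (l : nat) p : Prop :=
  (\sum_(0 <= k <oo) (k%:R ^+ l * p k)%:E < +oo)%E.

Definition mark_function q : Prop := forall k, 0 <= q k <= 1.

Definition p0 p q (k : nat) (e : bool) : R :=
  if e then p k * q k else p k * (1 - q k).

Definition marked_GW p q (P : probability tree_space R) : Prop :=
  forall (h : nat) (t : marked_tree), (1 <= h)%N ->
    P [set s : tree_space | restr h s = restr h t] =
    (\big[*%R/1]_(u \in [set u | nodes t u /\ (size u < h)%N])
       p0 p q (kids t u) (eta t u))%:E.

Definition hilbert_poly (l : nat) (x : R) : R :=
  (l`!)%:R^-1 * \prod_(0 <= j < l) (x - j%:R).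

Definition penalization (l : nat) (t : R) (n : nat) (s : tree_space) : R :=
  hilbert_poly l (generation_size n s)%:R
  * (mark_count n s == 0%N)%:R * t ^+ generation_size n s.

End marked_galton_watson.

(* Main.v *)
Require Import Defs.
From HB Require Import structures.
From mathcomp Require Import all_boot all_order all_algebra finmap.
From mathcomp Require Import all_classical all_reals all_analysis.
From mathcomp Require Import measurable_realfun zify ring lra.

Set Implicit Arguments.
Unset Strict Implicit.
Unset Printing Implicit Defensive.

Import Order.TTheory GRing.Theory Num.Theory.
Import numFieldNormedType.Exports.

Local Open Scope classical_set_scope.
Local Open Scope ring_scope.

(** Write [a k = p k (1 - q k)] and let [f_0 = t (1 + X)],
    [f_{m+1} = \sum_k a k f_m^k], truncated at degree [l].  Since
    [H_l(Z) t^Z] is the coefficient of [X^l] in [f_0^Z], the branching property gives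
    [E[1_Lam H_l(Z_{n+m}) 1{M_{n+m} = 0} t^{Z_{n+m}}]
       = E[1_Lam 1{M_n = 0} (f_m^{Z_n})_l]] for [Lam] in [F_n].
    On [M_n = 0], almost surely [Z_n >= k0 := r^n], so it suffices that
    [(f_m^k)_l = o((f_m^{k0})_l)] uniformly in [k > k0]: both expectations are then
    equivalent to the contribution of [Z_n = k0].
    This follows from two estimates.  First, [f_m] tends to [0] geometrically:
    for some [y > 0], [f_1(y) <= 1], and [a 0 = 0] yields
    [f_{m+1}(y) <= (\sum_k a k) f_m(y)] from then on, with [\sum_k a k < 1].
    Second, the coefficients of [f_m^{k0}] are eventually dominated by the top one:
    if [r > 1] or [l = 1], because [f_m^{k0}] is a nonnegative combination of powers
    [(1 + X)^k] with [k] large; if [r = 1], because [f_m(1)] and the top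
    coefficient of [f_m] are both of order [(a 1)^m]. *)

(* [HB.structures] exports another [eta], which shadows this one. *)
Local Notation eta := Defs.eta.
Local Notation nneg_poly := (polyOver (@Num.nneg _)).

(** * Marked trees: restrictions, generations and mark counts *)

Lemma marked_tree_eq (s t : marked_tree) :
  nodes s = nodes t -> marked s = marked t -> s = t.
Proof.
case: s t => [N M NT MN] [N' M' NT' MN'] /= eN eM; subst N' M'.
by rewrite (Prop_irrelevance NT NT') (Prop_irrelevance MN MN').
Qed.

Lemma restr_restr m n t : (m <= n)%N -> restr m (restr n t) = restr m t.
Proof.
move=> mn; apply: marked_tree_eq; apply/seteqP; split=> u /=.
- by case=> -[].
- by case=> tu um; split=> //; split=> //; exact: leq_trans mn.
- by case=> -[].
- by case=> tu um; split=> //; split=> //; exact: leq_trans mn.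
Qed.

Lemma restr_le m n s t : (m <= n)%N ->
  restr n s = restr n t -> restr m s = restr m t.
Proof. by move=> mn e; rewrite -(restr_restr s mn) e restr_restr. Qed.

Lemma nodes_kids t u j : nodes t u -> nodes t (rcons u j) <-> (0 < j <= kids t u)%N.
Proof.
move=> tu; have [_ _ /(_ u tu)[k tk]] := nodes_tree t.
by rewrite /kids; case: xgetP => [x _ /(_ j)|/(_ k)/(_ tk)].
Qed.

Lemma kids_eq s t u v : nodes s u -> nodes t v ->
  (forall j, nodes s (rcons u j) <-> nodes t (rcons v j)) -> kids s u = kids t v.
Proof.
move=> su tv h.
have key x y : (forall j, (0 < j <= x)%N <-> (0 < j <= y)%N) -> (x <= y)%N.
  by case: x => // x /(_ x.+1)[+ _]; rewrite leqnn /= => /(_ erefl).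
by apply/eqP; rewrite eqn_leq; apply/andP; split; apply: key => j;
  rewrite -!nodes_kids // h.
Qed.

Lemma nodes_rcons t u j : nodes t (rcons u j) -> nodes t u.
Proof. by have [_ h _] := nodes_tree t; exact: h. Qed.

Lemma restr_kids n t u : nodes t u -> (size u < n)%N -> kids (restr n t) u = kids t u.
Proof.
move=> tu un; apply: kids_eq => //; first by split=> //; exact: ltnW.
by move=> j; split=> [[]//|tuj]; split; rewrite ?size_rcons.
Qed.

Lemma restr_eta n t u : (size u < n)%N -> eta (restr n t) u = eta t u.
Proof. by move=> un; apply: asbool_equiv_eq; split=> [[]|]. Qed.

Lemma eq_restr_kids n s t u : restr n s = restr n t ->
  nodes s u -> (size u < n)%N -> kids s u = kids t u.
Proof.
move=> e su un; rewrite -(restr_kids su un) e restr_kids //.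
have : nodes (restr n s) u by split=> //; exact: ltnW.
by rewrite e => -[].
Qed.

Lemma eq_restr_eta n s t u : restr n s = restr n t ->
  (size u < n)%N -> eta s u = eta t u.
Proof. by move=> e un; rewrite -(restr_eta s un) e restr_eta. Qed.

Lemma eq_restr_nodes n s t u : restr n s = restr n t ->
  (size u <= n)%N -> nodes s u -> nodes t u.
Proof.
by move=> e un su; have : nodes (restr n s) u by []; rewrite e => -[].
Qed.

Lemma restrS_eq n s t :
  restr n.+1 s = restr n.+1 t <->
  restr n s = restr n t /\ (forall u, nodes s u -> size u = n ->
    kids s u = kids t u /\ eta s u = eta t u).
Proof.
split=> [e|[]].
  split; first by apply: restr_le e.
  by move=> u su un; split; [apply: (eq_restr_kids e)|apply: (eq_restr_eta e)];
    rewrite ?un.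
have key x y : restr n x = restr n y -> (forall u, nodes x u -> size u = n ->
    kids x u = kids y u /\ eta x u = eta y u) ->
    (nodes (restr n.+1 x) `<=` nodes (restr n.+1 y))
      /\ (marked (restr n.+1 x) `<=` marked (restr n.+1 y)).
  move=> e h; split=> u [xu un]; split=> //.
    move: un; rewrite leq_eqVlt => /predU1P[|un']; last exact: (eq_restr_nodes e).
    case/lastP: u xu => // u j xu; rewrite size_rcons => -[un].
    have xu' := nodes_rcons xu.
    have yu : nodes y u by apply: (eq_restr_nodes e) => //; rewrite un.
    by apply/nodes_kids => //; have [<- _] := h u xu' un; apply/nodes_kids.
  have xu' := marked_nodes xu.
  suff exy : eta x u = eta y u.
    by apply/asboolP; rewrite -/(eta y u) -exy; exact/asboolP.
  move: un; rewrite ltnS leq_eqVlt => /predU1P[/h[]//|]; exact: (eq_restr_eta e).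
move=> e h; have [N M] := key s t e h.
have [|N' M'] := key t s (esym e).
  move=> u tu un; have su : nodes s u by apply: (eq_restr_nodes (esym e)); rewrite ?un.
  by have [-> ->] := h u su un.
by apply: marked_tree_eq; apply/seteqP.
Qed.

Lemma finite_level n t : finite_set [set u | nodes t u /\ size u = n].
Proof.
elim: n => [|n IHn].
  by apply: (@sub_finite_set _ _ [set [::]]) => // u [_ /size0nil].
apply: (@sub_finite_set _ _ (\bigcup_(u in [set u | nodes t u /\ size u = n])
    (rcons u @` `I_(kids t u).+1))).
  move=> u [tu un]; case/lastP: u tu un => // u j tu; rewrite size_rcons => -[un].
  have tu' := nodes_rcons tu; exists u => //; exists j => //=.
  by move/(nodes_kids _ tu'): tu => /andP[].
by apply: bigcup_finite => // u _; apply/finite_image/finite_II.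
Qed.

Lemma finite_below n t : finite_set [set u | nodes t u /\ (size u < n)%N].
Proof.
apply: (@sub_finite_set _ _ (\bigcup_(i in `I_n) [set u | nodes t u /\ size u = i])).
  by move=> u [tu un]; exists (size u).
by apply: bigcup_finite => // i _; exact: finite_level.
Qed.

Definition level n t : seq (seq nat) :=
  fset_set [set u | nodes t u /\ size u = n].

Lemma mem_level n t u : (u \in level n t) <-> (nodes t u /\ size u = n).
Proof.
by rewrite /level in_fset_set; [rewrite in_setE|exact: finite_level].
Qed.

Lemma level_uniq n t : uniq (level n t).
Proof. exact: fset_uniq. Qed.

Lemma size_level n t : size (level n t) = generation_size n t.
Proof. by []. Qed.

Lemma eq_restr_level m n s t : (m <= n)%N -> restr n s = restr n t ->
  level m s = level m t.
Proof.
move=> mn e; rewrite /level; congr (enum_fset (fset_set _)).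
by apply/seteqP; split=> u [tu um]; split=> //;
  [apply: (eq_restr_nodes e)|apply: (eq_restr_nodes (esym e))]; rewrite ?um.
Qed.

Lemma generation_size0 t : generation_size 0 t = 1%N.
Proof.
rewrite -size_level (@perm_size _ _ [:: [::]]) //.
apply: uniq_perm => //; first exact: level_uniq.
move=> u; rewrite inE; apply/idP/eqP => [/mem_level[_ /size0nil]//|->].
by apply/mem_level; have [] := nodes_tree t.
Qed.

Lemma generation_sizeS n t :
  generation_size n.+1 t = (\sum_(u <- level n t) kids t u)%N.
Proof.
pose e := [seq rcons u j | u <- level n t, j <- iota 1 (kids t u)].
rewrite -size_level (@perm_size _ _ e).
  by rewrite size_allpairs_dep sumnE big_map; apply: eq_bigr => u _; rewrite size_iota.
apply: uniq_perm; first exact: level_uniq.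
  apply: allpairs_uniq_dep; first exact: level_uniq.
    by move=> u _; exact: iota_uniq.
  by move=> [u j] [v k] _ _ /= /rcons_inj[-> ->].
move=> u; apply/idP/allpairsPdep => [/mem_level[]|[v [j [/mem_level[tv vn]]]]].
  case/lastP: u => // u j tu; rewrite size_rcons => -[un].
  have tu' := nodes_rcons tu; exists u, j; split=> //; first exact/mem_level.
  by rewrite mem_iota add1n ltnS; apply/nodes_kids.
rewrite mem_iota add1n ltnS => /(nodes_kids _ tv) tvj ->.
by apply/mem_level; rewrite size_rcons vn.
Qed.

Lemma mark_count_eq0 n t :
  mark_count n t = 0%N <-> (forall u, nodes t u -> (size u < n)%N -> eta t u = false).
Proof.
rewrite /mark_count fsbig_finite /=; last exact: finite_below.
split=> [h u tu un|h].
  move/eqP: h; rewrite sum_nat_seq_eq0 => /allP /(_ u).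
  rewrite in_fset_set ?in_setE /= ?eqb0; last exact: finite_below.
  by move=> /(_ (conj tu un))/negbTE.
rewrite big_seq big1 // => u.
by rewrite in_fset_set ?in_setE; [move=> [tu un]; rewrite h|exact: finite_below].
Qed.

Lemma mark_countS_eq0 n t : mark_count n.+1 t = 0%N <->
  mark_count n t = 0%N /\ (forall u, u \in level n t -> eta t u = false).
Proof.
rewrite !mark_count_eq0; split=> [h|[h1 h2] u tu].
  split=> [u tu /ltnW|u /mem_level[tu un]]; first exact: h.
  by apply: h => //; rewrite un.
rewrite ltnS leq_eqVlt => /predU1P[un|]; last exact: h1.
by apply: h2; apply/mem_level.
Qed.

Lemma mark_count_restr m n s t : (m <= n)%N -> restr n s = restr n t ->
  mark_count m s = 0%N -> mark_count m t = 0%N.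
Proof.
move=> mn e /mark_count_eq0 h; apply/mark_count_eq0 => u tu um.
rewrite -(eq_restr_eta e); last exact: leq_trans mn.
apply: h => //; apply: (@eq_restr_nodes n t s) => //.
exact: leq_trans (ltnW um) mn.
Qed.

(** * Grafting prescribed offspring onto a generation *)

Section graft.
Variables (n : nat) (t : marked_tree) (c : seq nat -> nat).

(** Turns prescribed offspring numbers [c] at height [n] into an actual tree, because [marked_GW]
    gives probabilities only for restrictions of trees. With the marks of [restr n t], the nodes at
    height [n] are unmarked. *)
Definition graft_nodes : set (seq nat) :=
  nodes (restr n t) `|` [set v | exists u j,
    [/\ v = rcons u j, nodes t u, size u = n & (0 < j <= c u)%N]].

Lemma graft_nodes_tree : is_tree graft_nodes.
Proof.
have [r0 rp rk] := nodes_tree (restr n t); split.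
- by left.
- move=> u j [/rp tu|[v [i [/rcons_inj[-> _] tv vn _]]]]; first by left.
  by left; split=> //; rewrite vn.
- move=> u [ru|[v [i [-> tv vn ij]]]]; last first.
    exists 0%N => j; split=> [|/andP[]]; last by case: j.
    case=> [[_]|[w [k [/rcons_inj[e _] _ wn _]]]].
      by rewrite !size_rcons vn ltnNge leqnSn.
    by move/esym: wn; rewrite -e size_rcons vn => /n_Sn.
  case: (eqVneq (size u) n) => un.
    exists (c u) => j; split=> [[[_]|[w [k [/rcons_inj[-> ->]]]]]|uj] //.
      by rewrite size_rcons un ltnn.
    by right; exists u, j; split=> //; case: ru.
  have [k uk] := rk _ ru; exists k => j; rewrite -uk.
  split=> [[//|[w [i [/rcons_inj[e _] _ wn _]]]]|]; last by left.
  by rewrite e wn eqxx in un.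
Qed.

Lemma graft_marked : marked (restr n t) `<=` graft_nodes.
Proof. by move=> u /marked_nodes; left. Qed.

Definition graft := MarkedTree graft_nodes_tree graft_marked.

Lemma restr_graft : restr n graft = restr n t.
Proof.
apply: marked_tree_eq; apply/seteqP; split=> u /=.
- case=> -[[]//|[v [j [-> _ vn _]]]].
  by rewrite size_rcons vn ltnn.
- by case=> tu un; split=> //; left.
- by case=> -[].
- by case=> tu un.
Qed.

Lemma eta_graft u : size u = n -> eta graft u = false.
Proof. by move=> un; apply/asboolPn => -[_]; rewrite un ltnn. Qed.

Lemma kids_graft u : nodes t u -> size u = n -> kids graft u = c u.
Proof.
move=> tu un; have gu : nodes graft u by left; split=> //; rewrite un.
have key j : (0 < j <= kids graft u)%N <-> (0 < j <= c u)%N.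
  rewrite -nodes_kids //; split=> [[[_]|[v [i [/rcons_inj[<- <-]]]]]|uj] //.
    by rewrite size_rcons un ltnn.
  by right; exists u, j.
apply/eqP; rewrite eqn_leq; apply/andP; split.
  by case E : (kids graft u) key => // [x] /(_ x.+1)[+ _]; rewrite leqnn => /(_ erefl).
by case E : (c u) key => // [x] /(_ x.+1)[_]; rewrite leqnn => /(_ erefl).
Qed.

End graft.

(** * Polynomials with nonnegative coefficients *)

Section nonneg_poly.
Context {R : realType}.
Implicit Types (F H : {poly R}) (y : R).

Lemma nneg_coef F j : F \is a nneg_poly -> 0 <= F`_j.
Proof. by move/polyOverP/(_ j). Qed.

Lemma nneg_polyX F k : F \is a nneg_poly -> F ^+ k \is a nneg_poly.
Proof.
move=> F0; elim: k => [|k IHk]; apply/polyOverP => j; rewrite nnegrE.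
  by rewrite coef1.
by rewrite exprS coefM sumr_ge0 // => i _; rewrite mulr_ge0 ?nneg_coef.
Qed.

Lemma horner_nneg_wide F y n : F \is a nneg_poly -> 0 <= y ->
  \sum_(j < n) F`_j * y ^+ j <= F.[y].
Proof.
move=> F0 y0; rewrite (@horner_coef_wide _ (maxn n (size F))) ?leq_maxr//.
rewrite -!(big_mkord xpredT (fun j => F`_j * y ^+ j)).
rewrite (big_cat_nat (leq0n n) (leq_maxl _ _)) /= lerDl.
by apply: sumr_ge0 => j _; rewrite mulr_ge0 ?exprn_ge0// nneg_coef.
Qed.

Lemma coef_le_horner F y j : F \is a nneg_poly -> 0 <= y ->
  F`_j * y ^+ j <= F.[y].
Proof.
move=> F0 y0; apply: le_trans (horner_nneg_wide j.+1 F0 y0).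
rewrite big_ord_recr /= lerDr; apply: sumr_ge0 => i _.
by rewrite mulr_ge0 ?exprn_ge0// nneg_coef.
Qed.

Lemma horner_nneg F y : F \is a nneg_poly -> 0 <= y -> 0 <= F.[y].
Proof. by move=> F0 y0; have := horner_nneg_wide 0 F0 y0; rewrite big_ord0. Qed.

Lemma coefM_ge F H i j : F \is a nneg_poly -> H \is a nneg_poly ->
  F`_i * H`_j <= (F * H)`_(i + j).
Proof.
move=> F0 H0; have ij : (i < (i + j).+1)%N by rewrite ltnS leq_addr.
rewrite coefM (bigD1 (Ordinal ij)) //= addKn lerDl.
by apply: sumr_ge0 => k _; rewrite mulr_ge0 ?nneg_coef.
Qed.

(** The order of [F] at 0 is at least [N]; it is exactly [N] only when [c] is nonzero. *)
Definition low_term (N : nat) (c : R) F := (forall j, (j < N)%N -> F`_j = 0) /\ F`_N = c.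

Lemma low_termM N M c d F H : low_term N c F -> low_term M d H ->
  low_term (N + M) (c * d) (F * H).
Proof.
move=> [F0 Fc] [H0 Hd]; split=> [j jNM|].
  rewrite coefM big1 // => i _; case: (ltnP i N) => iN; first by rewrite F0 ?mul0r.
  by rewrite H0 ?mulr0 //; have := ltn_ord i; lia.
have NNM : (N < (N + M).+1)%N by rewrite ltnS leq_addr.
rewrite coefM (bigD1 (Ordinal NNM)) //= addKn Fc Hd big1 ?addr0 // => i iN.
have {iN}: (i : nat) != N by apply: contraNneq iN => iN; apply/eqP/val_inj.
rewrite neq_ltn => /orP[iN|Ni]; first by rewrite F0 ?mul0r.
by rewrite H0 ?mulr0 //; have := ltn_ord i; lia.
Qed.

Lemma low_termX N c F k : low_term N c F -> low_term (k * N) (c ^+ k) (F ^+ k).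
Proof.
move=> Fc; elim: k => [|k IHk]; first by split=> //; rewrite coef1.
by rewrite mulSn !exprS; exact: low_termM.
Qed.

(* [F = \sum_k d_k (1 + X)^k] with [d_k >= 0] for [k >= N] and [d_k = 0] otherwise
   satisfies [(1 + X) F' >= N F]; this form is stable under truncation. *)
Definition shifted_order (l N : nat) F := forall j, (j < l)%N ->
  N%:R * F`_j <= ((1 + 'X) * F^`())`_j.

Lemma coef_shifted F j :
  ((1 + 'X) * F^`())`_j = j.+1%:R * F`_j.+1 + j%:R * F`_j.
Proof.
rewrite mulrDl mul1r coefD coefXM !coef_deriv !mulr_natl.
by case: j => [|j] //=; rewrite mulr0n.
Qed.

(** Leibniz rule: (1 + X)(FH)' = ((1 + X)F') H + F ((1 + X)H'). Coefficients of index below [l] of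
    either product only involve the assumed inequalities of index below [l]. *)
Lemma shifted_orderM l N M F H : F \is a nneg_poly -> H \is a nneg_poly ->
  shifted_order l N F -> shifted_order l M H -> shifted_order l (N + M) (F * H).
Proof.
move=> F0 H0 FN HM j jl.
rewrite derivM mulrDr mulrA (mulrCA _ F) coefD natrD mulrDl.
apply: lerD; rewrite !coefM mulr_sumr; apply: ler_sum => i _.
  rewrite mulrA ler_wpM2r ?nneg_coef // FN //.
  by apply: leq_ltn_trans jl; rewrite -ltnS.
rewrite mulrCA ler_wpM2l ?nneg_coef // HM //.
by apply: leq_ltn_trans jl; exact: leq_subr.
Qed.

Lemma shifted_orderX l N F k : F \is a nneg_poly ->
  shifted_order l N F -> shifted_order l (k * N) (F ^+ k).
Proof.
move=> F0 FN; elim: k => [|k IHk].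
  by move=> j _; rewrite mul0r coef_shifted !mulr_natl expr0 coef1 /= mul0rn
    coef1 add0r; case: j => //= j; rewrite mul0rn.
by rewrite mulSn exprS; apply: shifted_orderM => //; exact: nneg_polyX.
Qed.

(** The hypothesis reads (j+1) F_{j+1} >= (N-j) F_j, and N-j >= j+1 for j < l as soon as 2l <= N+1.
    So the coefficients are nondecreasing up to degree [l]. *)
Lemma shifted_order_coef_le l N F : F \is a nneg_poly -> shifted_order l N F ->
  (l.*2 <= N.+1)%N -> forall j, (j <= l)%N -> F`_j <= F`_l.
Proof.
move=> F0 FN lN j jl; rewrite -(subKn jl).
elim: (l - j)%N (leq_subr j l) => [|i IHi] il; first by rewrite subn0.
apply: le_trans (IHi (ltnW il)).
have il' : (l - i.+1 < l)%N by rewrite ltn_subrL /= (leq_trans _ il).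
have := FN _ il'; rewrite coef_shifted (_ : (l - i = (l - i.+1).+1)%N); last by lia.
set k := (l - i.+1)%N in il' *; move=> h.
have kN : (k.+1 + k <= N)%N by rewrite addSn addnn; lia.
rewrite -(@ler_pM2l _ k.+1%:R) ?ltr0n //.
rewrite -(lerD2r (k%:R * F`_k)); apply: le_trans h.
by rewrite -mulrDl -natrD ler_wpM2r ?nneg_coef // ler_nat.
Qed.

End nonneg_poly.

(** * Truncated composition with the generating function of the weights [a] *)

Section truncated_composition.
Context {R : realType} (a : nat -> R).
Hypothesis a_ge0 : forall k, 0 <= a k.
Implicit Types (F G : {poly R}).

Definition gf_coef F (j : nat) : \bar R :=
  (\sum_(0 <= k <oo) (a k * (F ^+ k)`_j)%:E)%E.

Definition gf_summable (L : nat) F := forall j, (j <= L)%N -> (gf_coef F j < +oo)%E.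

(* Coefficients whose series diverges are junk: [fine +oo = 0]. *)
Definition gf_comp (L : nat) F : {poly R} := \poly_(j < L.+1) fine (gf_coef F j).

Lemma gf_term_ge0 F j k : F \is a nneg_poly -> (0 <= (a k * (F ^+ k)`_j)%:E)%E.
Proof. by move=> F0; rewrite lee_fin mulr_ge0 // nneg_coef // nneg_polyX. Qed.

Lemma gf_coef_ge0 F j : F \is a nneg_poly -> (0 <= gf_coef F j)%E.
Proof. by move=> F0; apply: nneseries_ge0 => k _ _; exact: gf_term_ge0. Qed.

Lemma gf_comp_nneg L F : F \is a nneg_poly -> gf_comp L F \is a nneg_poly.
Proof.
move=> F0; apply/polyOverP => j; rewrite nnegrE coef_poly; case: ifP => // _.
by apply: fine_ge0; exact: gf_coef_ge0.
Qed.

Lemma gf_compE L F j : F \is a nneg_poly -> gf_summable L F -> (j <= L)%N ->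
  ((gf_comp L F)`_j)%:E = gf_coef F j.
Proof.
move=> F0 FL jL; rewrite coef_poly ltnS jL fineK //.
by rewrite ge0_fin_numE ?gf_coef_ge0 // FL.
Qed.

Lemma gf_comp_ge_term L F j k : F \is a nneg_poly -> gf_summable L F ->
  (j <= L)%N -> a k * (F ^+ k)`_j <= (gf_comp L F)`_j.
Proof.
move=> F0 FL jL; rewrite -lee_fin gf_compE // /gf_coef (@nneseriesD1 _ _ k) //.
  rewrite leeDl //; apply: nneseries_ge0 => i _ _; exact: gf_term_ge0.
by move=> i _; exact: gf_term_ge0.
Qed.

(** Nonnegativity allows the sums over [j] and [k] to be exchanged. Only an inequality results,
    since the truncation drops the degrees above [L]. *)
Lemma gf_comp_horner_le L F y : F \is a nneg_poly -> gf_summable L F -> 0 <= y ->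
  ((gf_comp L F).[y]%:E <= \sum_(0 <= k <oo) (a k * F.[y] ^+ k)%:E)%E.
Proof.
move=> F0 FL y0; rewrite (@horner_coef_wide _ L.+1) ?size_poly // -sumEFin.
rewrite (eq_bigr (fun j : 'I_L.+1 => \sum_(0 <= k <oo) (a k * (F ^+ k)`_j * y ^+ j)%:E))%E;
  last first.
  move=> j _; have jL : (j <= L)%N by rewrite -ltnS.
  rewrite mulrC EFinM gf_compE //.
  rewrite -nneseriesZl; last by move=> k _; exact: gf_term_ge0.
  by apply: eq_eseriesr => k _; rewrite -EFinM mulrC.
rewrite -nneseries_sum; last first.
  move=> j k _; rewrite lee_fin mulr_ge0 ?exprn_ge0 // mulr_ge0 //.
  by rewrite nneg_coef // nneg_polyX.
apply: lee_nneseries => k _.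
  by move=> _; apply: sume_ge0 => j _; rewrite lee_fin mulr_ge0 ?exprn_ge0 //
    mulr_ge0 // nneg_coef // nneg_polyX.
rewrite sumEFin lee_fin -horner_exp.
under eq_bigr do rewrite -mulrA.
rewrite -mulr_sumr ler_wpM2l //; apply: horner_nneg_wide => //.
exact: nneg_polyX.
Qed.

Section contraction.
Variable (s : R).
Hypothesis a_sum : (\sum_(0 <= k <oo) (a k)%:E)%E = s%:E.

(** The bound (F^k)_j y^j <= F(y)^k <= 1 makes the coefficients of the powers bounded uniformly in
    [k], and [a] is summable. *)
Lemma gf_summable_horner L F y : F \is a nneg_poly -> 0 < y -> F.[y] <= 1 ->
  gf_summable L F.
Proof.
move=> F0 y0 F1 j _.
apply: (@le_lt_trans _ _ (\sum_(0 <= k <oo) ((y ^+ j)^-1)%:E * (a k)%:E)%E).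
  apply: lee_nneseries => k _; first by move=> _; exact: gf_term_ge0.
  rewrite -EFinM lee_fin mulrC ler_wpM2r //.
  rewrite -[leRHS]mul1r ler_pdivlMr ?exprn_gt0 //.
  apply: le_trans (coef_le_horner _ (nneg_polyX k F0) (ltW y0)) _.
  by rewrite horner_exp exprn_ile1 // horner_nneg // ltW.
rewrite nneseriesZl; last by move=> k _; rewrite lee_fin.
by rewrite a_sum -EFinM ltry.
Qed.

(** Only k >= 1 contributes, and then F(y)^k <= F(y). *)
Lemma gf_comp_contract L F y : a 0%N = 0 -> F \is a nneg_poly -> gf_summable L F ->
  0 <= y -> F.[y] <= 1 -> (gf_comp L F).[y] <= s * F.[y].
Proof.
move=> a0 F0 FL y0 F1; have Fy0 := horner_nneg F0 y0.
rewrite -lee_fin; apply: le_trans (gf_comp_horner_le F0 FL y0) _.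
rewrite mulrC EFinM -a_sum -nneseriesZl; last by move=> k _; rewrite lee_fin.
apply: lee_nneseries => k; first by rewrite lee_fin mulr_ge0 ?exprn_ge0.
move=> _; rewrite -EFinM lee_fin mulrC.
by case: k => [|k]; rewrite ?a0 ?mulr0 // ler_wpM2r // exprS ler_piMr // exprn_ile1.
Qed.

End contraction.

Section order.
Variable r : nat.
Hypothesis a_lt : forall k, (k < r)%N -> a k = 0.

(** In degree rN only k = r contributes: smaller [k] have weight 0, and for larger [k] the power F^k
    starts at degree kN > rN. *)
Lemma gf_comp_low_term L N c F : F \is a nneg_poly -> (0 < N)%N ->
  (r * N <= L)%N -> gf_summable L F -> low_term N c F ->
  low_term (r * N) (a r * c ^+ r) (gf_comp L F).
Proof.
move=> F0 N0 rNL FL Fc; have low k := low_termX k Fc.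
have lowt j k : (j < r * N)%N -> a k * (F ^+ k)`_j = 0.
  move=> jrN; case: (ltnP k r) => kr; first by rewrite a_lt ?mul0r.
  have [lowk _] := low k; rewrite lowk ?mulr0 //.
  by apply: leq_trans jrN _; rewrite leq_mul2r kr orbT.
split=> [j jrN|]; apply: EFin_inj; rewrite gf_compE //.
- by apply: eseries0 => k _ _; rewrite lowt.
- by apply: leq_trans rNL; exact: ltnW.
rewrite /gf_coef (@nneseriesD1 _ _ r) //; last by move=> k _; exact: gf_term_ge0.
rewrite eseries0 ?adde0 => [|k _ /= kr]; first by have [_ ->] := low r.
congr EFin; move: kr; rewrite neq_ltn => /orP[kr|rk]; first by rewrite a_lt ?mul0r.
by have [lowk _] := low k; rewrite lowk ?mulr0 // ltn_mul2r rk N0.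
Qed.

(** The defining inequality is linear, hence preserved by nonnegative combinations, and every F^k
    with nonzero weight has shifted order kN >= rN. *)
Lemma gf_comp_shifted_order l N F : F \is a nneg_poly -> gf_summable l F ->
  shifted_order l N F -> shifted_order l (r * N) (gf_comp l F).
Proof.
move=> F0 FL FN j jl; rewrite coef_shifted -lee_fin EFinD !EFinM.
rewrite !gf_compE // 1?ltnW // -!nneseriesZl; do ?by move=> k _; exact: gf_term_ge0.
rewrite -nneseriesD; do ?by move=> k _ _; rewrite mule_ge0 // gf_term_ge0.
apply: lee_nneseries => k _.
  by move=> _; rewrite mule_ge0 // gf_term_ge0.
rewrite -!EFinM -EFinD lee_fin !(mulrCA _ (a k)) -mulrDr.
case: (ltnP k r) => kr; first by rewrite a_lt ?mul0r.
rewrite ler_wpM2l // -coef_shifted.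
apply: le_trans (shifted_orderX k F0 FN jl).
by rewrite ler_wpM2r ?nneg_coef ?nneg_polyX // ler_nat leq_mul2r kr orbT.
Qed.

End order.

End truncated_composition.

(** * Decay and coefficient comparison for the iterates [f m] *)

Section penalized_generating_functions.
Context {R : realType} (a : nat -> R) (s t : R) (l r : nat).
Hypothesis a_ge0 : forall k, 0 <= a k.
Hypothesis a_sum : (\sum_(0 <= k <oo) (a k)%:E)%E = s%:E.
Hypothesis s_lt1 : s < 1.
Hypothesis r_gt0 : (0 < r)%N.
Hypothesis ar_gt0 : 0 < a r.
Hypothesis a_lt : forall k, (k < r)%N -> a k = 0.
Hypothesis a_moment : (\sum_(0 <= k <oo) (k%:R ^+ l * a k)%:E < +oo)%E.
Hypothesis t_gt0 : 0 < t.
Hypothesis t_le1 : t <= 1.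

Definition pen_poly (m : nat) : {poly R} := iter m (gf_comp a l) (t *: (1 + 'X)).

Local Notation f := pen_poly.

Lemma pen_poly0_coef k j : ((t *: (1 + 'X)) ^+ k)`_j = t ^+ k * ('C(k, j))%:R :> R.
Proof.
rewrite exprZn coefZ; congr (_ * _); rewrite exprDn coef_sum.
case: (ltnP j k.+1) => jk.
  rewrite (bigD1 (Ordinal jk)) //= big1 ?addr0 => [|i ij].
    by rewrite expr1n mul1r coefMn coefXn eqxx.
  rewrite expr1n mul1r coefMn coefXn; case: eqP => [e|]; last by rewrite mul0rn.
  by move/eqP: ij; case; apply: val_inj; rewrite /= e.
rewrite bin_small // big1 // => i _.
rewrite expr1n mul1r coefMn coefXn; case: eqP => [e|]; last by rewrite mul0rn.
by have := ltn_ord i; rewrite -e ltnNge jk.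
Qed.

Lemma pen_poly_nneg m : f m \is a nneg_poly.
Proof.
elim: m => [|m IHm]; last exact: gf_comp_nneg.
apply/polyOverP => j; rewrite nnegrE /= -[_ *: _]expr1 pen_poly0_coef.
by rewrite mulr_ge0 ?exprn_ge0 // ltW.
Qed.
Hint Resolve pen_poly_nneg : core.

Lemma a0_eq0 : a 0%N = 0. Proof. exact: a_lt. Qed.

Lemma s_gt0 : 0 < s.
Proof.
apply: lt_le_trans ar_gt0 _; rewrite -lee_fin -a_sum (@nneseriesD1 _ _ r) //.
  by rewrite leeDl //; apply: nneseries_ge0 => i _ _; rewrite lee_fin.
by move=> i _; rewrite lee_fin.
Qed.

(** Lets the moment of order [l] control the binomial coefficients in the powers of [f 0]. *)
Lemma bin_leq_exp n j : (j <= l)%N -> (0 < n)%N -> ('C(n, j) <= n ^ l)%N.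
Proof.
move=> jl n0; apply: (@leq_trans (n ^ j)); last exact: leq_pexp2l.
elim: j {jl} n n0 => [|j IHj] [|n] // _.
apply: (@leq_trans (n.+1 * 'C(n, j))).
  by rewrite (mul_bin_diag n.+1 j) leq_pmull.
rewrite expnS leq_mul2l; case: n => [|n]; first by rewrite bin0n exp1n; case: j {IHj}.
by apply: leq_trans (IHj n.+1 _) _ => //; case: j {IHj} => // j; rewrite leq_exp2r.
Qed.

Lemma pen_poly_summable0 : gf_summable a l (f 0).
Proof.
move=> j jl; apply: le_lt_trans a_moment.
apply: lee_nneseries => k _; first by move=> _; exact: gf_term_ge0 (pen_poly_nneg 0).
rewrite lee_fin pen_poly0_coef mulrC.
case: k => [|k]; first by rewrite a0_eq0 !mulr0.
rewrite ler_wpM2r // -natrX -[leRHS]mul1r ler_pM ?exprn_ge0 ?ler_nat //.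
- exact: ltW.
- by rewrite exprn_ile1 // ltW.
- exact: bin_leq_exp.
Qed.

(** The constant coefficient of [f 1] is at most s < 1, so a small enough [y] works. *)
Lemma pen_poly1_small : exists2 y : R, 0 < y <= 1 & (f 1).[y] <= 1.
Proof.
have F0 := pen_poly_nneg 1; set F := f 1 in F0 *.
have F0s : F`_0 <= s.
  rewrite -lee_fin (gf_compE a_ge0 (pen_poly_nneg 0) pen_poly_summable0) // -a_sum.
  apply: lee_nneseries => k _; first by move=> _; exact: gf_term_ge0 (pen_poly_nneg 0).
  by rewrite lee_fin pen_poly0_coef bin0 mulr1 ler_piMr // exprn_ile1 // ltW.
have F1 : 0 <= F.[1] by rewrite horner_nneg.
(* For y <= 1, F(y) <= F_0 + y F(1); the second term of the minimum makes y F(1) <= 1 - s, and the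
   added 1 keeps the denominator positive. *)
exists (Num.min 1 ((1 - s) / (F.[1] + 1))).
  rewrite ge_min lexx /= andbT lt_min ltr01 /= divr_gt0 ?subr_gt0 //.
  by rewrite ltr_wpDl.
set y := Num.min _ _.
have y0 : 0 <= y by rewrite le_min ler01 /= divr_ge0 // ?subr_ge0 ?addr_ge0 // ltW.
have y1 : y <= 1 by rewrite ge_min lexx.
have yF : y * (F.[1] + 1) <= 1 - s.
  by rewrite -ler_pdivlMr ?ltr_wpDl // ge_min lexx orbT.
have : F.[y] <= F`_0 + y * F.[1].
  rewrite !horner_coef; case: (size F) => [|n].
    by rewrite !big_ord0 mulr0 addr0 nneg_coef.
  rewrite !big_ord_recl /= expr0 mulr1 lerD2l mulrDr.
  rewrite -[leLHS]add0r lerD ?mulr_ge0 ?nneg_coef ?exprn_ge0 //.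
  rewrite mulr_sumr; apply: ler_sum => i _.
  rewrite expr1n mulr1 mulrC ler_wpM2r ?nneg_coef //.
  by rewrite exprS ler_piMr // exprn_ile1.
nra.
Qed.

(** The moment hypothesis handles [f 0]. From [f 1] on, the value at the point [y] stays at most 1
    by contraction, which gives summability. *)
Lemma pen_poly_summable m : gf_summable a l (f m).
Proof.
case: m => [|m]; first exact: pen_poly_summable0.
have [y /andP[y0 y1] F1] := pen_poly1_small.
suff [H _] : gf_summable a l (f m.+1) /\ (f m.+1).[y] <= 1 by [].
elim: m => [|m [Hm IHm]].
  split; last exact: F1.
  exact: (gf_summable_horner a_ge0 a_sum (pen_poly_nneg 1) y0 F1).
have F1' : (f m.+2).[y] <= 1.
  apply: le_trans (gf_comp_contract a_ge0 a_sum a0_eq0 _ Hm _ IHm) _ => //.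
    exact: ltW.
  apply: mulr_ile1 IHm; [exact: ltW s_gt0| |exact: ltW].
  by rewrite horner_nneg // ltW.
split; last exact: F1'.
exact: (gf_summable_horner a_ge0 a_sum (pen_poly_nneg m.+2) y0 F1').
Qed.

Lemma pen_poly_ge_term m j k : (j <= l)%N -> a k * (f m ^+ k)`_j <= (f m.+1)`_j.
Proof. by move=> jl; apply: gf_comp_ge_term => //; exact: pen_poly_summable. Qed.

(** The contraction gives the rate [s] at the small point [y]. Since [f m.+1] has degree at most
    [l], moving from [y] to 1 costs only a factor y^{-l}. *)
Lemma pen_poly_decay : exists2 K : R, 0 < K & forall m, (f m.+1).[1] <= K * s ^+ m.
Proof.
have [y /andP[y0 y1] F1] := pen_poly1_small.
have decay m : (f m.+1).[y] <= s ^+ m.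
  elim: m => [//|m IHm]; rewrite exprS.
  have F1' : (f m.+1).[y] <= 1.
    by apply: le_trans IHm _; rewrite exprn_ile1 // ltW // s_gt0.
  apply: le_trans (gf_comp_contract a_ge0 a_sum a0_eq0 (pen_poly_nneg m.+1)
    (@pen_poly_summable m.+1) (ltW y0) F1') _.
  by rewrite ler_wpM2l // ltW // s_gt0.
exists (y ^- l) => [|m]; first by rewrite invr_gt0 exprn_gt0.
rewrite mulrC ler_pdivlMr ?exprn_gt0 //; apply: le_trans (decay m).
rewrite !(@horner_coef_wide _ l.+1) ?size_poly // mulr_suml.
apply: ler_sum => j _; rewrite expr1n mulr1 ler_wpM2l ?nneg_coef //.
by apply: ler_wiXn2l => //; [exact: ltW|rewrite -ltnS].
Qed.

Lemma pen_poly_coef0_gt0 m : 0 < (f m)`_0.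
Proof.
elim: m => [|m IHm].
  by rewrite /= -[_ *: _]expr1 pen_poly0_coef bin0 mulr1 expr1.
apply: lt_le_trans (pen_poly_ge_term m r (leq0n l)).
rewrite mulr_gt0 //; elim: r => [|k IHk]; first by rewrite coef1.
rewrite exprS; apply: lt_le_trans (coefM_ge 0 0 _ _) => //.
  by rewrite mulr_gt0.
exact: nneg_polyX.
Qed.

(** The initial t(1 + X) has shifted order 1, and each composition multiplies the order by [r]. *)
Lemma pen_poly_shifted_order m : shifted_order l (r ^ m) (f m).
Proof.
elim: m => [|m IHm].
  move=> j _; rewrite coef_shifted /= -[_ *: _]expr1 !pen_poly0_coef.
  case: j => [|[|j]].
  - by rewrite bin0 bin1 mul0r addr0.
  - by rewrite (@bin_small 1 2) // !mulr0 add0r.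
  - by rewrite !bin_small // !mulr0 addr0.
rewrite expnS; apply: gf_comp_shifted_order => //; exact: pen_poly_summable.
Qed.

(* Koenigs-type estimate: [f m] at 1 and its top coefficient both decay like
   [a 1 ^+ m], because [s ^+ m] is summable. *)
Lemma pen_poly_koenigs k2 : r = 1%N -> (0 < l)%N -> (1 < k2)%N -> 0 < a k2 ->
  exists (C : R) m0, 0 < C /\ forall m, (m0 <= m)%N -> (f m).[1] <= C * (f m)`_l.
Proof.
move=> r1 l0 k21 ak2; have a1 : 0 < a 1%N by rewrite -r1.
(* Each iteration makes one more coefficient positive: the term [k2] >= 2 contains the product of
   the coefficients of degrees j+1 and 1. *)
have pos m j : (j <= l)%N -> (j <= m.+1)%N -> 0 < (f m)`_j.
  elim: m j => [|m IHm] [|j] jl jm; try exact: pen_poly_coef0_gt0.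
    case: j jm jl => // _ _.
    by rewrite /= -[_ *: _]expr1 pen_poly0_coef bin1 mulr1 expr1.
  case: j jm jl => [_ _|j jm jl].
    apply: lt_le_trans (pen_poly_ge_term m 1 l0).
    by rewrite mulr_gt0 // expr1 IHm.
  apply: lt_le_trans (pen_poly_ge_term m k2 jl).
  rewrite mulr_gt0 // -(subnKC k21) addSn addSn add0n !exprS mulrA.
  rewrite -(addn0 j.+2).
  apply: lt_le_trans (coefM_ge _ _ _ _); last exact: nneg_polyX.
    rewrite mulr_gt0 //; last first.
      elim: (k2 - 2)%N => [|k IHk]; first by rewrite coef1.
      rewrite exprS; apply: lt_le_trans (coefM_ge 0 0 _ _) => //.
        by rewrite mulr_gt0 // pen_poly_coef0_gt0.
      exact: nneg_polyX.
    rewrite -(addn1 j.+1); apply: lt_le_trans (coefM_ge _ _ _ _) => //.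
    by rewrite mulr_gt0 // IHm //; lia.
  by rewrite -expr2 nneg_polyX.
have [K K0 decay] := pen_poly_decay.
have s0 := s_gt0; have s1 : 0 < 1 - s by rewrite subr_gt0.
(* For k >= 2 and S <= 1, S^k <= S^2; moreover [a 0] = 0 and the weights sum to at most 1. *)
have stepS m : (f m).[1] <= 1 ->
    (f m.+1).[1] <= a 1%N * (f m).[1] + (f m).[1] ^+ 2.
  set S := (f m).[1] => S1; have S0 : 0 <= S by exact: horner_nneg.
  rewrite -lee_fin; apply: le_trans (gf_comp_horner_le a_ge0 _ _ _) _ => //.
    exact: pen_poly_summable.
  rewrite -/S (@nneseriesD1 _ _ 1) //; last first.
    by move=> k _; rewrite lee_fin mulr_ge0 ?exprn_ge0.
  rewrite expr1 EFinD leeD2l //.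
  apply: (@le_trans _ _ (\sum_(0 <= k <oo | k != 1%N) (S ^+ 2)%:E * (a k)%:E)%E).
    apply: lee_nneseries => k; first by rewrite lee_fin mulr_ge0 ?exprn_ge0.
    case: k => [|[|k]] //= _; rewrite -EFinM lee_fin mulrC.
      by rewrite a0_eq0 !mulr0.
    rewrite ler_wpM2r // !exprS expr0 mulr1 mulrA ler_piMr ?mulr_ge0 //.
    by rewrite exprn_ile1.
  apply: (@le_trans _ _ (\sum_(0 <= k <oo) (S ^+ 2)%:E * (a k)%:E)%E).
    apply: subset_lee_nneseries => // k _.
    by rewrite -EFinM lee_fin mulr_ge0 ?exprn_ge0.
  rewrite nneseriesZl; last by move=> k _; rewrite lee_fin.
  by rewrite a_sum -EFinM lee_fin ler_piMr ?exprn_ge0 // ltW.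
have [m1 S_le1] : exists m1, forall m, (m1 <= m)%N -> (f m.+1).[1] <= 1.
  have : K * s ^+ m @[m --> \oo] --> 0.
    rewrite -[X in _ --> X](mulr0 K); apply: cvgMr.
    by apply: cvg_expr; rewrite ger0_norm // ltW.
  move/cvgr0Pnorm_le => /(_ 1 ltr01)[m1 _ h]; exists m1 => m m1m.
  apply: le_trans (decay m) (le_trans (ler_norm _) (h m m1m)).
(* Chosen so that B s^m - B s^{m+1} = K s^m / [a 1], which bounds the relative error of one step. *)
pose B : R := K / (a 1%N * (1 - s)).
have B0 : 0 < B by rewrite divr_gt0 // mulr_gt0.
pose m0 := maxn m1 l.
(* Makes the invariant below an equality at [m0]. *)
pose C : R := (f m0.+1).[1] / (f m0.+1)`_l * expR (B * s ^+ m0).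
have w0 : 0 < (f m0.+1)`_l by apply: pos => //; rewrite leqW // leqW // leq_maxr.
have Sm0 : 0 < (f m0.+1).[1].
  apply: lt_le_trans w0 _.
  by have := coef_le_horner l (pen_poly_nneg m0.+1) ler01; rewrite expr1n mulr1.
have C0 : 0 < C by rewrite mulr_gt0 ?divr_gt0 // expR_gt0.
(* The exponential factor absorbs the product of the errors 1 + S/[a 1]: one step multiplies the top
   coefficient by at least [a 1], and the exponentials telescope. *)
suff inv i : (f (m0 + i).+1).[1] <= C * (f (m0 + i).+1)`_l * expR (- (B * s ^+ (m0 + i))).
  exists C, m0.+1; split=> // m; case: m => // m; rewrite ltnS => m0m.
  rewrite -(subnKC m0m); apply: le_trans (inv _) _.
  apply: ler_piMr; first by apply: mulr_ge0; [exact: ltW|exact: nneg_coef].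
  by rewrite expR_le1 oppr_le0 mulr_ge0 ?exprn_ge0 // ltW.
elim: i => [|i IHi].
  rewrite addn0 expRN /C [X in _ <= X](_ : _ = (f m0.+1).[1]) //.
  by field; rewrite !gt_eqF ?expR_gt0.
rewrite addnS; set m := (m0 + i)%N in IHi *.
set S := (f m.+1).[1] in IHi *.
have S0 : 0 <= S by exact: horner_nneg.
have S1 : S <= 1 by apply: S_le1; rewrite (leq_trans (leq_maxl m1 l)) ?leq_addr.
apply: le_trans (stepS m.+1 S1) _; rewrite -/S.
have -> : a 1%N * S + S ^+ 2 = a 1%N * (1 + S / a 1%N) * S by field; rewrite gt_eqF.
have hexp : 1 + S / a 1%N <= expR (B * s ^+ m - B * s ^+ m.+1).
  apply: le_trans (expR_ge1Dx _); rewrite lerD2l ler_pdivrMr //.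
  have -> : (B * s ^+ m - B * s ^+ m.+1) * a 1%N = K * s ^+ m.
    by rewrite exprS /B; field; rewrite !gt_eqF.
  exact: decay.
apply: (@le_trans _ _ (a 1%N * expR (B * s ^+ m - B * s ^+ m.+1) *
    (C * (f m.+1)`_l * expR (- (B * s ^+ m))))).
  apply: ler_pM => //; last by rewrite ler_pM2l.
  by rewrite mulr_ge0 ?addr_ge0 ?divr_ge0 // ltW.
rewrite expRD.
have -> : a 1%N * (expR (B * s ^+ m) * expR (- (B * s ^+ m.+1))) *
    (C * (f m.+1)`_l * expR (- (B * s ^+ m)))
  = C * (a 1%N * (f m.+1)`_l) * expR (- (B * s ^+ m.+1)).
  by rewrite !expRN; field; rewrite !gt_eqF ?expR_gt0.
rewrite ler_wpM2r ?expR_ge0 // ler_wpM2l ?(ltW C0) //.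
by apply: le_trans (pen_poly_ge_term m.+1 1 (leqnn l)); rewrite expr1.
Qed.

Hypothesis l_gt0 : (0 < l)%N.
Hypothesis nondegenerate :
  [\/ l = 1%N, (1 < r)%N | exists2 k : nat, (2 <= k)%N & 0 < a k].

(** If r > 1, the shifted order r^n r^m eventually exceeds 2l; if r = l = 1, the order 1 already
    satisfies 2l <= N + 1. In the remaining case r = 1 with some [a k] > 0, k >= 2, the Koenigs-type
    estimate applies. *)
Lemma pen_poly_coef_le n : exists (C : R) m0, 0 < C /\
  forall m, (m0 <= m)%N -> forall j, (j <= l)%N ->
    (f m ^+ (r ^ n))`_j <= C * (f m ^+ (r ^ n))`_l.
Proof.
have shifted m : (l.*2 <= (r ^ n * r ^ m).+1)%N -> forall j, (j <= l)%N ->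
    (f m ^+ (r ^ n))`_j <= 1 * (f m ^+ (r ^ n))`_l.
  move=> lN j jl; rewrite mul1r.
  apply: (shifted_order_coef_le (nneg_polyX _ (pen_poly_nneg m)) _ lN jl).
  exact/shifted_orderX/pen_poly_shifted_order.
have [r1|r1] := ltnP 1 r.
  exists 1, l.*2; split=> // m lm; apply: shifted; apply: leq_trans lm _.
  apply: leqW; apply: leq_trans (ltnW (ltn_expl m r1)) _.
  by rewrite leq_pmull // expn_gt0 r_gt0.
have {}r1 : r = 1%N by apply/eqP; rewrite eqn_leq r1 r_gt0.
case: nondegenerate => [l1||[k2 k21 ak2]]; last 1 first.
- have [C [m0 [C0 H]]] := pen_poly_koenigs r1 l_gt0 k21 ak2.
  exists C, m0; split=> // m m0m j jl; rewrite r1 exp1n expr1.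
  apply: le_trans (H m m0m).
  by have := coef_le_horner j (pen_poly_nneg m) ler01; rewrite expr1n mulr1.
- exists 1, 0%N; split=> // m _; apply: shifted.
  by rewrite l1 ltnS muln_gt0 !expn_gt0 r_gt0.
- by rewrite r1.
Qed.

(** Write F^k as F^{r^n} F^{d+1}. In the convolution giving the coefficient of degree [l], the first
    factors are at most C times the top one, and the second are at most F(1)^{d+1} <= F(1) <= K
    s^m. *)
Lemma pen_poly_dominated n : exists (C : R) m0, 0 < C /\
  forall m, (m0 <= m)%N -> 0 < (f m.+1 ^+ (r ^ n))`_l /\
    forall k, (r ^ n < k)%N ->
      (f m.+1 ^+ k)`_l <= C * s ^+ m * (f m.+1 ^+ (r ^ n))`_l.
Proof.
have [C [m1 [C0 H]]] := pen_poly_coef_le n.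
have [K K0 decay] := pen_poly_decay.
have [m2 small] : exists m2, forall m, (m2 <= m)%N -> (f m.+1).[1] <= 1.
  have : K * s ^+ m @[m --> \oo] --> 0.
    rewrite -[X in _ --> X](mulr0 K); apply: cvgMr.
    by apply: cvg_expr; rewrite ger0_norm // ltW // s_gt0.
  move/cvgr0Pnorm_le => /(_ 1 ltr01)[m2 _ h]; exists m2 => m m2m.
  exact: le_trans (decay m) (le_trans (ler_norm _) (h m m2m)).
exists (l.+1%:R * C * K), (maxn m1 m2); split; first by rewrite !mulr_gt0.
move=> m; rewrite geq_max => /andP[m1m m2m].
have {}H j jl := H m.+1 (leqW m1m) j jl.
(* The top coefficient dominates the constant one, which is positive. *)
have w0 : 0 < (f m.+1 ^+ (r ^ n))`_l.
  rewrite -(pmulr_rgt0 _ C0); apply: lt_le_trans (H 0%N (leq0n l)).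
  elim: (r ^ n)%N => [|k IHk]; first by rewrite coef1.
  rewrite exprS; apply: lt_le_trans (coefM_ge 0 0 _ _) => //.
    by rewrite mulr_gt0 // pen_poly_coef0_gt0.
  exact: nneg_polyX.
split=> // k kn; rewrite -(subnKC kn) addSnnS exprD coefM.
set d := (k - _)%N; set w := (f m.+1 ^+ (r ^ n))`_l in w0 *.
have S0 : 0 <= (f m.+1).[1] by exact: horner_nneg.
have -> : l.+1%:R * C * K * s ^+ m * w = \sum_(i < l.+1) C * w * (K * s ^+ m).
  by rewrite sumr_const card_ord -mulr_natl; ring.
apply: ler_sum => i _; apply: ler_pM.
- by rewrite nneg_coef // nneg_polyX.
- by rewrite nneg_coef // nneg_polyX.
- by rewrite H // -ltnS.
have := coef_le_horner (l - i) (nneg_polyX d.+1 (pen_poly_nneg m.+1)) ler01.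
rewrite expr1n mulr1 => /le_trans; apply.
rewrite horner_exp exprS; apply: le_trans (decay m).
by rewrite ler_piMr // exprn_ile1 // small.
Qed.

End penalized_generating_functions.

(** * Events and functions depending only on the first generations *)

Definition tree_determined (n : nat) (A : set tree_space) :=
  forall s t : tree_space, restr n s = restr n t -> A s -> A t.

Lemma tree_filtrationP n (A : set tree_space) :
  tree_filtration n A <-> tree_determined n A.
Proof.
split=> [[B _ <-] s t e [_ Bs]|An]; first by split=> //=; rewrite -e.
exists (restr n @` A) => //; apply/seteqP; split=> [s [_ [t At e]]|s As].
  exact: An e At.
by split=> //; exists s.
Qed.

Lemma tree_determined_le m n A : (m <= n)%N -> tree_determined m A -> tree_determined n A.
Proof. by move=> mn Am s t /(restr_le mn); exact: Am. Qed.

Lemma tree_determined_measurable n A : tree_determined n A -> measurable A.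
Proof. by move=> /tree_filtrationP An; apply: sub_sigma_algebra; exists n. Qed.

Lemma tree_determined_fun_measurable (R : realType) n (f : tree_space -> R) :
  (forall s t, restr n s = restr n t -> f s = f t) -> measurable_fun setT f.
Proof.
move=> fn _ B _; rewrite setTI; apply: (@tree_determined_measurable n) => s t e.
by rewrite /= (fn s t e).
Qed.

(** Labels the values of [restr n] by integers, so that splitting an event into atoms of the
    filtration is a countable partition. *)
Definition tree_code (n : nat) (s : tree_space) : nat :=
  @choice.pickle (seq (seq nat) * seq (seq nat))%type
    (enum_fset (fset_set (nodes (restr n s))),
     enum_fset (fset_set (marked (restr n s)))).

Lemma tree_code_inj n s t : tree_code n s = tree_code n t -> restr n s = restr n t.
Proof.
have fin u : finite_set (nodes (restr n u)).
  apply: (@sub_finite_set _ _ [set v | nodes u v /\ (size v < n.+1)%N]) => //.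
  exact: finite_below.
have finm u : finite_set (marked (restr n u)).
  by apply: sub_finite_set (fin u); exact: marked_nodes.
move/(pcan_inj choice.pickleK) => -[e1 e2].
by apply: marked_tree_eq; apply: fset_set_inj => //; exact: val_inj.
Qed.

(** * The branching property on the event without marks *)

Section markov.
Context {R : realType} (p q : nat -> R) (P : probability tree_space R).
Hypothesis p_ge0 : forall k, 0 <= p k.
Hypothesis q01 : mark_function q.
Hypothesis hP : marked_GW p q P.

Local Notation a := (fun k => p0 p q k false).

Lemma p0_false_ge0 k : 0 <= a k.
Proof. by rewrite /p0 mulr_ge0 // subr_ge0; have /andP[] := q01 k. Qed.
Hint Resolve p0_false_ge0 : core.

(** With F = t(1 + X) and j = l this is the penalization; with F = X it is the indicator of no mark
    below height [n] and [j] nodes at height [n]. *)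
Definition unmarked_gf (n : nat) (F : {poly R}) (j : nat) (s : tree_space) : R :=
  (mark_count n s == 0%N)%:R * (F ^+ generation_size n s)`_j.

Lemma unmarked_gf_ge0 n F j s : F \is a nneg_poly -> 0 <= unmarked_gf n F j s.
Proof. by move=> F0; rewrite mulr_ge0 // nneg_coef // nneg_polyX. Qed.

Lemma mark_count_eq n s t : restr n s = restr n t ->
  (mark_count n s == 0%N) = (mark_count n t == 0%N).
Proof.
by move=> e; apply/eqP/eqP;
  [exact: (mark_count_restr (leqnn n) e)|exact: (mark_count_restr (leqnn n) (esym e))].
Qed.

Lemma generation_size_eq n s t : restr n s = restr n t ->
  generation_size n s = generation_size n t.
Proof. by move=> e; rewrite -!size_level (eq_restr_level (leqnn n) e). Qed.

Lemma unmarked_gf_determined n F j s t : restr n s = restr n t ->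
  unmarked_gf n F j s = unmarked_gf n F j t.
Proof.
by move=> e; rewrite /unmarked_gf (mark_count_eq e) (generation_size_eq e).
Qed.

Lemma unmarked_gf_measurable n F j :
  measurable_fun setT (EFin \o unmarked_gf n F j).
Proof.
apply/measurable_EFinP; apply: (@tree_determined_fun_measurable _ n).
exact: unmarked_gf_determined.
Qed.

Lemma integral_label (f : tree_space -> \bar R) (N : tree_space -> nat)
    (D : set tree_space) :
  (forall i, measurable (D `&` [set s | N s = i])) ->
  measurable_fun setT f -> (forall s, 0 <= f s)%E ->
  (\int[P]_(s in D) f s =
   \sum_(0 <= i <oo) \int[P]_(s in D `&` [set s | N s = i]) f s)%E.
Proof.
move=> mD mf f0.
have DE : D = \bigcup_i (D `&` [set s | N s = i]).
  apply/seteqP; split=> [s Ds|s [i _ []] //]; by exists (N s).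
rewrite {1}DE ge0_integral_bigcup //.
- exact: measurable_funS mf.
- apply/trivIsetP => i j _ _ ij; apply/seteqP; split=> // s [[_ /= Ni] [_ /= Nj]].
  by rewrite -Ni -Nj eqxx in ij.
Qed.

Lemma integral_eqr (D : set tree_space) (f : tree_space -> \bar R) (c : R) :
  measurable D -> (forall s, D s -> f s = c%:E) ->
  (\int[P]_(s in D) f s = c%:E * P D)%E.
Proof.
move=> mD fc; rewrite -integral_cst //; apply: eq_integral => s.
by rewrite inE => /fc.
Qed.

(** Averaging over the offspring of one node replaces its F^k by [gf_comp a L F]; [H] carries the
    contribution of the other nodes. Coefficients up to [L] are not affected by the truncation. *)
Lemma p0_gf_coefM L (F H : {poly R}) j :
  F \is a nneg_poly -> H \is a nneg_poly -> gf_summable a L F -> (j <= L)%N ->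
  (\sum_(0 <= k <oo) (a k * (H * F ^+ k)`_j)%:E = ((H * gf_comp a L F)`_j)%:E)%E.
Proof.
move=> F0 H0 FL jL; rewrite coefM -sumEFin.
have Fk0 i k : (0 <= (a k * (F ^+ k)`_i)%:E)%E.
  by rewrite lee_fin mulr_ge0 // nneg_coef // nneg_polyX.
rewrite [RHS](eq_bigr (fun i : 'I_j.+1 =>
    \sum_(0 <= k <oo) ((H`_i)%:E * (a k * (F ^+ k)`_(j - i))%:E)))%E; last first.
  move=> i _; rewrite EFinM gf_compE //; last exact: leq_trans (leq_subr _ _) jL.
  by rewrite nneseriesZl.
rewrite -nneseries_sum; last first.
  by move=> i k _; rewrite mule_ge0 // lee_fin nneg_coef.
apply: eq_eseriesr => k _; rewrite coefM mulr_sumr -sumEFin.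
by apply: eq_bigr => i _; rewrite -EFinM; congr EFin; ring.
Qed.

(** [ks] may be shorter than the generation, so these events interpolate between an atom at height
    [n] and an atom at height [n.+1]. *)
Definition revealed (n : nat) (t : marked_tree) (ks : seq nat) : set tree_space :=
  [set s | restr n s = restr n t /\ forall i, (i < size ks)%N ->
     kids s (nth [::] (level n t) i) = nth 0%N ks i /\
     eta s (nth [::] (level n t) i) = false].

Lemma revealed_determined n t ks : (size ks <= generation_size n t)%N ->
  tree_determined n.+1 (revealed n t ks).
Proof.
move=> ksn s s' e [est H]; have /restrS_eq[e' K] := e.
split=> [|i ik]; first by rewrite -e'.
have [] := H i ik; set u := nth _ _ i => <- <-.
have /mem_level[tu un] : u \in level n t.
  by rewrite mem_nth // size_level (leq_trans ik).
have su : nodes s u by apply: (eq_restr_nodes (esym est)); rewrite ?un.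
by have [-> ->] := K u su un.
Qed.

(** Extends [marked_GW] to height 0, where every tree restricts to the root and the product is
    empty. *)
Lemma prob_atom n (t : marked_tree) :
  P [set s | restr n s = restr n t] =
  (\prod_(u <- fset_set [set u | nodes t u /\ (size u < n)%N])
     p0 p q (kids t u) (eta t u))%:E.
Proof.
case: n => [|n].
  rewrite (_ : [set s | _] = setT) ?probability_setT.
    by rewrite (_ : [set u | _] = set0) ?fset_set0 ?big_nil //; apply/seteqP; split=> u // [].
  apply/seteqP; split=> // s _ /=; apply: marked_tree_eq; apply/seteqP; split=> u /=.
  - by case=> _; rewrite leqn0 => /nilP ->; split=> //; have [] := nodes_tree t.
  - by case=> _; rewrite leqn0 => /nilP ->; split=> //; have [] := nodes_tree s.
  - by case.
  - by case.
by rewrite hP // fsbig_finite //; exact: finite_below.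
Qed.

(** Once the whole generation is revealed, the event is the atom at height [n.+1] of a grafted tree,
    and the product over its nodes splits into those below height [n] and those at height [n]. *)
Lemma prob_revealed n t ks : size ks = generation_size n t ->
  P (revealed n t ks) =
  (P [set s | restr n s = restr n t] * (\prod_(k <- ks) p0 p q k false)%:E)%E.
Proof.
move=> sks; pose c u := nth 0%N ks (index u (level n t)).
have gt := restr_graft n t c; set g := graft n t c in gt.
have lgt : level n g = level n t by exact: eq_restr_level gt.
have cE : ks = [seq c u | u <- level n t].
  apply: (@eq_from_nth _ 0%N); first by rewrite size_map size_level.
  move=> i ik.
  have il : (i < size (level n t))%N by rewrite size_level -sks.
  by rewrite (nth_map [::]) // /c index_uniq // level_uniq.
have -> : revealed n t ks = [set s | restr n.+1 s = restr n.+1 g].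
  apply/seteqP; split=> s /=.
    case=> est H; apply/restrS_eq; split=> [|u su un]; first by rewrite gt.
    have tu : nodes t u by apply: (eq_restr_nodes est); rewrite ?un.
    have ul : u \in level n t by exact/mem_level.
    rewrite kids_graft // eta_graft // /c.
    by have := H (index u (level n t)); rewrite nth_index // sks -size_level index_mem => /(_ ul).
  move=> /restrS_eq[est H]; split=> [|i ik]; first by rewrite est gt.
  have ul : nth [::] (level n t) i \in level n t by rewrite mem_nth // size_level -sks.
  have /mem_level[tu un] := ul.
  have su : nodes s (nth [::] (level n t) i).
    by apply: (@eq_restr_nodes n t s); rewrite ?un // est gt.
  have [-> ->] := H _ su un.
  rewrite kids_graft // eta_graft // /c index_uniq // ?size_level -?sks //.
  exact: level_uniq.
rewrite -gt !prob_atom -EFinM; congr EFin.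
rewrite -!fsbig_finite; do ?exact: finite_below.
have -> : [set u | nodes g u /\ (size u < n.+1)%N] =
    [set u | nodes g u /\ (size u < n)%N] `|` [set u | nodes g u /\ size u = n].
  apply/seteqP; split=> u /=.
    by case=> gu; rewrite ltnS leq_eqVlt => /predU1P[un|un]; [right|left].
  by case=> -[gu un]; split=> //; rewrite ltnS ?un // ltnW.
rewrite fsbigU0; [|exact: finite_below|exact: finite_level|].
  congr (_ * _); rewrite fsbig_finite; last exact: finite_level.
  rewrite -/(level n g) lgt [in RHS]cE big_map.
  apply: eq_big_seq => u /mem_level[tu un].
  by rewrite kids_graft // eta_graft.
by move=> u [[_ +] [_ un]]; rewrite un ltnn.
Qed.

(* The offspring of the nodes at height [n] are revealed one node at a time. *)
Lemma unmarked_gf_revealed n t ks (F : {poly R}) L j :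
  F \is a nneg_poly -> gf_summable a L F -> (j <= L)%N ->
  mark_count n t = 0%N -> (size ks <= generation_size n t)%N ->
  (\int[P]_(s in revealed n t ks) (unmarked_gf n.+1 F j s)%:E =
   P [set s | restr n s = restr n t] *
   (\prod_(k <- ks) p0 p q k false *
    (F ^+ sumn ks * gf_comp a L F ^+ (generation_size n t - size ks))`_j)%:E)%E.
Proof.
move=> F0 FL jL t0 ksn.
have [d dE] : exists d, (generation_size n t - size ks)%N = d.
  by exists (generation_size n t - size ks)%N.
(* Induction on the number [d] of nodes still hidden; at d = 0 the integrand is constant on the
   event. *)
elim: d ks ksn dE => [|d IHd] ks ksn dE; rewrite dE.
  have sks : size ks = generation_size n t by lia.
  rewrite (integral_eqr (c := (F ^+ sumn ks)`_j)).
  - by rewrite prob_revealed // expr0 mulr1 muleCA -EFinM mulrC.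
  - exact: tree_determined_measurable (revealed_determined ksn).
  move=> s [est H]; rewrite /unmarked_gf.
  have lst : level n s = level n t by exact: eq_restr_level est.
  have -> : mark_count n.+1 s = 0%N.
    apply/mark_countS_eq0; split; first by apply/eqP; rewrite (mark_count_eq est) t0.
    move=> u; rewrite lst => ul.
    have [] := H (index u (level n t)); last by rewrite nth_index.
    by rewrite sks -size_level index_mem.
  rewrite mul1r; congr (((F ^+ _)`_j)%:E).
  rewrite generation_sizeS lst sumnE (big_nth [::]) [RHS](big_nth 0%N).
  rewrite size_level -sks big_nat [RHS]big_nat.
  by apply: eq_bigr => i /andP[_ /H[]].
set u := nth [::] (level n t) (size ks).
have ul : u \in level n t by rewrite mem_nth // size_level; lia.
have /mem_level[tu un] := ul.
(* Reveals the next node [u]. The part where [u] is marked contributes nothing, because the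
   integrand vanishes there. *)
have uD k : revealed n t ks `&` [set s | kids s u = k] =
    revealed n t (rcons ks k) `|` (revealed n t ks `&` [set s | kids s u = k /\ eta s u]).
  apply/seteqP; split=> s /=.
    case=> -[est H] su; case E : (eta s u); [by right|left; split=> // i].
    rewrite size_rcons ltnS leq_eqVlt => /predU1P[->|ik].
      by rewrite nth_rcons ltnn eqxx.
    by rewrite nth_rcons ik; exact: H.
  case=> [[est H]|[[est H] [su _]]] //; split=> [|]; last first.
    by have [] := H (size ks); rewrite ?size_rcons // nth_rcons ltnn eqxx.
  split=> // i ik; have [|] := H i; first by rewrite size_rcons ltnW.
  by rewrite nth_rcons ik.
have mD k : measurable (revealed n t ks `&` [set s | kids s u = k]).
  apply: (@tree_determined_measurable n.+1) => s s' e [Ds su]; split.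
    exact: revealed_determined Ds.
  rewrite /= -su; symmetry; apply: (eq_restr_kids e); rewrite ?un //.
  by have [est _] := Ds; apply: (eq_restr_nodes (esym est)); rewrite ?un.
rewrite (integral_label mD); last 2 first.
- exact: unmarked_gf_measurable.
- by move=> s; rewrite lee_fin unmarked_gf_ge0.
have ksn' k : (size (rcons ks k) <= generation_size n t)%N by rewrite size_rcons; lia.
transitivity (\sum_(0 <= k <oo)
    \int[P]_(s in revealed n t (rcons ks k)) (unmarked_gf n.+1 F j s)%:E)%E.
  apply: eq_eseriesr => k _; rewrite [LHS]integral_mkcond [RHS]integral_mkcond.
  apply: eq_integral => s _; rewrite /patch uD in_setU.
  case: (boolP (s \in revealed n t (rcons ks k))) => //= _.
  case: ifPn => //; rewrite inE => -[[est _] [_ su]].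
  rewrite /unmarked_gf; case: eqP => [/mark_countS_eq0[_ /(_ u)]|]; last by rewrite mul0r.
  by rewrite su (eq_restr_level (leqnn n) est) => /(_ ul).
(* After the induction hypothesis, the sum over [k] turns the factor F^k of [u] into one more factor
   [gf_comp a L F]. *)
transitivity (\sum_(0 <= k <oo) (P [set s | restr n s = restr n t] *
   (\prod_(k <- ks) p0 p q k false)%:E * (p0 p q k false *
    (F ^+ sumn ks * gf_comp a L F ^+ d * F ^+ k)`_j)%:E))%E.
  apply: eq_eseriesr => k _; rewrite IHd //; last by rewrite size_rcons; lia.
  rewrite -muleA -EFinM; congr (_ * _%:E)%E.
  rewrite -cats1 big_cat big_seq1 /= sumn_cat /= addn0 exprD size_cat /=.
  have -> : (generation_size n t - (size ks + 1) = d)%N by lia.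
  by rewrite -mulrA; congr (_ * (_ * _`_j)); rewrite mulrAC.
have G0 : F ^+ sumn ks * gf_comp a L F ^+ d \is a nneg_poly.
  apply/polyOverP => i; rewrite nnegrE coefM sumr_ge0 // => i' _.
  by rewrite mulr_ge0 ?nneg_coef ?nneg_polyX // gf_comp_nneg.
have Pfin : P [set s | restr n s = restr n t] \is a fin_num.
  apply: fin_num_measure; apply: (@tree_determined_measurable n) => s s' e /= <-.
  by symmetry.
rewrite -(fineK Pfin) -EFinM nneseriesZl; last first.
  move=> k _; rewrite lee_fin mulr_ge0 // coefM sumr_ge0 // => i _.
  by rewrite mulr_ge0 ?nneg_coef ?nneg_polyX.
by rewrite (p0_gf_coefM F0 G0 FL jL) -!EFinM exprSr; congr EFin; rewrite !mulrA.
Qed.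

(** [Lam] is a countable union of atoms at height [n]. On an atom with a mark both integrands
    vanish; on the others the revealing lemma applies with no node revealed yet. *)
Lemma markov_step n (Lam : set tree_space) (F : {poly R}) L j :
  tree_filtration n Lam ->
  F \is a nneg_poly -> gf_summable a L F -> (j <= L)%N ->
  (\int[P]_(s in Lam) (unmarked_gf n.+1 F j s)%:E =
   \int[P]_(s in Lam) (unmarked_gf n (gf_comp a L F) j s)%:E)%E.
Proof.
move=> /tree_filtrationP Ln F0 FL jL.
have G0 := gf_comp_nneg p0_false_ge0 L F0.
have mL k : measurable (Lam `&` [set s | tree_code n s = k]).
  apply: (@tree_determined_measurable n) => s s' e [Ls <-].
  by split; [exact: Ln Ls|rewrite /= /tree_code e].
rewrite !(integral_label mL); do ?exact: unmarked_gf_measurable; last 2 first.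
- by move=> s; rewrite lee_fin unmarked_gf_ge0.
- by move=> s; rewrite lee_fin unmarked_gf_ge0.
apply: eq_eseriesr => k _.
have [->|/set0P[t [Lt tk]]] := eqVneq (Lam `&` [set s | tree_code n s = k]) set0.
  by rewrite !integral_set0.
have mat : measurable [set s : tree_space | restr n s = restr n t].
  by apply: (@tree_determined_measurable n) => s s' /= ->.
have -> : Lam `&` [set s | tree_code n s = k] = [set s | restr n s = restr n t].
  apply/seteqP; split=> s /=.
    by case=> _; rewrite -tk; exact: tree_code_inj.
  by move=> e; split; [exact: Ln Lt|rewrite -tk /tree_code e].
have [t0|t0] := eqVneq (mark_count n t) 0%N; last first.
  apply: eq_integral => s; rewrite inE => est; rewrite /unmarked_gf.
  rewrite (mark_count_eq est) (negbTE t0) mul0r; case: eqP; last by rewrite mul0r.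
  by move=> /mark_countS_eq0[/eqP]; rewrite (mark_count_eq est) (negbTE t0).
have := @unmarked_gf_revealed n t [::] F L j F0 FL jL t0 (leq0n _).
have -> : revealed n t [::] = [set s | restr n s = restr n t].
  by apply/seteqP; split=> s // [].
move=> ->; rewrite big_nil mul1r /= expr0 mul1r subn0.
rewrite (integral_eqr (c := (gf_comp a L F ^+ generation_size n t)`_j)) //.
  by rewrite muleC.
move=> s est; rewrite /unmarked_gf (mark_count_eq est) (generation_size_eq est).
by rewrite t0 mul1r.
Qed.

Lemma markov n m (Lam : set tree_space) (F : {poly R}) L j :
  tree_filtration n Lam -> F \is a nneg_poly ->
  (forall i, gf_summable a L (iter i (gf_comp a L) F)) -> (j <= L)%N ->
  (\int[P]_(s in Lam) (unmarked_gf (n + m) F j s)%:E =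
   \int[P]_(s in Lam) (unmarked_gf n (iter m (gf_comp a L) F) j s)%:E)%E.
Proof.
move=> Ln F0 FL jL; elim: m F F0 FL => [|m IHm] F F0 FL; first by rewrite addn0.
have Lnm : tree_filtration (n + m) Lam.
  apply/tree_filtrationP; apply: tree_determined_le (leq_addr m n) _.
  exact/tree_filtrationP.
rewrite addnS (markov_step Lnm F0 (FL 0%N) jL) IHm ?iterSr //.
  exact: gf_comp_nneg.
by move=> i; rewrite -iterSr; exact: FL i.+1.
Qed.

End markov.

(** * The penalization as a coefficient of a power of t(1 + X) *)

Lemma hilbert_poly_nat (R : realType) l n :
  hilbert_poly l n%:R = ('C(n, l))%:R :> R.
Proof.
have E m : \prod_(0 <= j < m) (n%:R - j%:R) = (n ^_ m)%:R :> R.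
  elim: m => [|m IHm]; first by rewrite big_nil ffactn0.
  rewrite big_nat_recr //= IHm ffactnSr natrM.
  case: (leqP m n) => mn; first by rewrite natrB.
  by rewrite ffact_small // !mul0r.
by rewrite /hilbert_poly E -bin_ffact natrM mulrCA mulVf ?mulr1 // pnatr_eq0 -lt0n fact_gt0.
Qed.

Lemma penalizationE (R : realType) l (t : R) n s :
  penalization l t n s = unmarked_gf n (t *: (1 + 'X)) l s.
Proof.
rewrite /penalization /unmarked_gf hilbert_poly_nat pen_poly0_coef.
by ring.
Qed.

Lemma expectation_indic (R : realType) (P : probability tree_space R)
    (D : set tree_space) (X : tree_space -> R) :
  ('E_P[(fun s => \1_D s * X s)%R] = \int[P]_(s in D) (X s)%:E)%E.
Proof.
rewrite unlock [RHS]integral_mkcond; apply: eq_integral => s _.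
by rewrite /patch indicE; case: ifP => _; rewrite ?mul1r ?mul0r.
Qed.

(** * Law of the generation size without marks, and its minimal value r^n *)

Section law_of_unmarked_generation.
Context {R : realType} (p q : nat -> R) (P : probability tree_space R) (r : nat) (s : R).
Hypothesis p_ge0 : forall k, 0 <= p k.
Hypothesis q01 : mark_function q.
Hypothesis hP : marked_GW p q P.

Local Notation a := (fun k => p0 p q k false).

Hypothesis a_sum : (\sum_(0 <= k <oo) (a k)%:E)%E = s%:E.
Hypothesis s_ge0 : 0 <= s.
Hypothesis s_le1 : s <= 1.
Hypothesis r_gt0 : (0 < r)%N.
Hypothesis a_lt : forall k, (k < r)%N -> a k = 0.

Definition unmarked_size (n k : nat) : set tree_space :=
  [set u | (mark_count n u == 0%N) && (generation_size n u == k)].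

Lemma unmarked_size_determined n k : tree_determined n (unmarked_size n k).
Proof.
move=> u v e; rewrite /unmarked_size /=.
by rewrite (mark_count_eq e) (generation_size_eq e).
Qed.

Lemma unmarked_size_measurable n k : measurable (unmarked_size n k).
Proof. exact: tree_determined_measurable (@unmarked_size_determined n k). Qed.

Lemma iter_X_summable L i : gf_summable a L (iter i (gf_comp a L) 'X).
Proof.
suff [F0 F1] : iter i (gf_comp a L) 'X \is a nneg_poly /\
    (iter i (gf_comp a L) 'X).[1] <= 1.
  exact: (gf_summable_horner (p0_false_ge0 p_ge0 q01) a_sum F0 ltr01 F1).
elim: i => [|i [F0 F1]] /=.
  split; last by rewrite hornerX.
  by apply/polyOverP => j; rewrite nnegrE coefX.
have FL := gf_summable_horner (p0_false_ge0 p_ge0 q01) a_sum F0 ltr01 F1 (L := L).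
split; first exact: gf_comp_nneg (p0_false_ge0 p_ge0 q01) _ _ F0.
apply: le_trans (gf_comp_contract (p0_false_ge0 p_ge0 q01) a_sum (a_lt r_gt0) F0 FL
  ler01 F1) _.
by apply: mulr_ile1 => //; exact: horner_nneg.
Qed.

(** The branching property with F = X identifies these probabilities with the coefficients of the
    [n]-th iterate from X, truncated at degree r^n. Each composition multiplies the order by [r]. *)
Lemma prob_unmarked_size n : low_term (r ^ n) (p0 p q r false ^+ (\sum_(i < n) r ^ i))
  (\poly_(k < (r ^ n).+1) fine (P (unmarked_size n k))).
Proof.
pose L := (r ^ n)%N; pose h i := iter i (gf_comp a L) 'X.
have X0 : 'X \is a (nneg_poly : qualifier _ {poly R}).
  by apply/polyOverP => j; rewrite nnegrE coefX.
have h0 i : h i \is a nneg_poly.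
  by elim: i => // i IHi; exact: gf_comp_nneg (p0_false_ge0 p_ge0 q01) _ _ IHi.
have low i : (i <= n)%N ->
    low_term (r ^ i) (p0 p q r false ^+ (\sum_(j < i) r ^ j)) (h i).
  elim: i => [_|i IHi ni].
    by rewrite big_ord0 /h /=; split=> [[]//|]; rewrite coefX.
  have -> : p0 p q r false ^+ (\sum_(j < i.+1) r ^ j) =
      p0 p q r false * (p0 p q r false ^+ (\sum_(j < i) r ^ j)) ^+ r.
    rewrite -exprM -exprS big_ord_recl add1n; congr (_ ^+ _.+1).
    by rewrite mulnC big_distrr; apply: eq_bigr => j _; rewrite /= expnS.
  rewrite expnS; apply: (gf_comp_low_term (p0_false_ge0 p_ge0 q01) a_lt (h0 i)).
  - by rewrite expn_gt0 r_gt0.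
  - by rewrite -expnS leq_pexp2l.
  - exact: iter_X_summable.
  - exact: IHi (ltnW ni).
have PE k : (k <= L)%N -> P (unmarked_size n k) = ((h n)`_k)%:E.
  move=> kL.
  have T0 m : tree_filtration m [set: tree_space] by apply/tree_filtrationP.
  have E0 : (\int[P]_(u in setT) (unmarked_gf 0 (h n) k u)%:E = ((h n)`_k)%:E)%E.
    rewrite (@integral_eqr _ P setT _ (h n)`_k measurableT).
      by rewrite probability_setT mule1.
    move=> u _; rewrite /unmarked_gf generation_size0 expr1.
    by have [_|/eqP[]] := eqVneq (mark_count 0 u) 0%N; [rewrite mul1r|apply/mark_count_eq0].
  rewrite -E0 -(markov p_ge0 q01 hP n (T0 0%N) X0 (@iter_X_summable L) kL) add0n.
  rewrite -[unmarked_size n k]setIT -(integral_indic P measurableT (unmarked_size_measurable n k)).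
  apply: eq_integral => u _; rewrite /unmarked_gf coefXn indicE; congr EFin.
  have -> : (u \in unmarked_size n k) = (mark_count n u == 0%N) && (generation_size n u == k).
    by apply/idP/idP; rewrite inE.
  by rewrite -natrM mulnb (eq_sym k).
have [lo top] := low n (leqnn n).
split=> [k kL|]; rewrite coef_poly.
  by rewrite ltnS (ltnW kL) PE ?(ltnW kL) //= lo.
by rewrite ltnSn PE.
Qed.

Lemma prob_unmarked_size_fin n k : P (unmarked_size n k) \is a fin_num.
Proof. exact: fin_num_measure (unmarked_size_measurable n k). Qed.

Lemma prob_unmarked_size_min n :
  P (unmarked_size n (r ^ n)) = (p0 p q r false ^+ (\sum_(i < n) r ^ i))%:E.
Proof.
have [_] := prob_unmarked_size n; rewrite coef_poly ltnSn => <-.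
by rewrite fineK // prob_unmarked_size_fin.
Qed.

Lemma prob_unmarked_size_lt n k : (k < r ^ n)%N -> P (unmarked_size n k) = 0.
Proof.
move=> kr; have [/(_ k kr) + _] := prob_unmarked_size n.
rewrite coef_poly ltnS (ltnW kr) => P0.
by rewrite -(fineK (prob_unmarked_size_fin n k)) P0.
Qed.

(** The part of [D] with no mark and minimal generation size gives the main term exactly. Elsewhere
    the integrand is almost surely at most [e] times the minimal coefficient. *)
Lemma unmarked_gf_bounds n (D : set tree_space) (F : {poly R}) l (e : R) :
  tree_filtration n D -> F \is a nneg_poly -> 0 <= e ->
  (forall k, (r ^ n < k)%N -> (F ^+ k)`_l <= e * (F ^+ (r ^ n))`_l) ->
  let w := ((F ^+ (r ^ n))`_l)%:E in
  let PD := P (D `&` unmarked_size n (r ^ n)) in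
  (w * PD <= \int[P]_(u in D) (unmarked_gf n F l u)%:E)%E /\
  (\int[P]_(u in D) (unmarked_gf n F l u)%:E <= w * PD + (e * (F ^+ (r ^ n))`_l)%:E)%E.
Proof.
move=> /tree_filtrationP Dn F0 e0 Fe w PD.
set A := unmarked_size n (r ^ n).
have mD : measurable D := tree_determined_measurable Dn.
have mA : measurable A := unmarked_size_measurable n (r ^ n).
have mDA : measurable (D `&` A) by exact: measurableI.
have mDA' : measurable (D `\` A) by exact: measurableD.
have w0 : 0 <= (F ^+ (r ^ n))`_l by rewrite nneg_coef // nneg_polyX.
have mu B : measurable_fun B (EFin \o unmarked_gf n F l : tree_space -> \bar R).
  by apply: measurable_funS (unmarked_gf_measurable _ _ _) => //; exact: measurableT.
have u0 u : (0 <= (unmarked_gf n F l u)%:E)%E by rewrite lee_fin unmarked_gf_ge0.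
have intA : (\int[P]_(u in D `&` A) (unmarked_gf n F l u)%:E = w * PD)%E.
  rewrite (@integral_eqr _ P _ _ ((F ^+ (r ^ n))`_l)) // => u [_ /andP[/eqP M /eqP Z]].
  by rewrite /unmarked_gf M Z mul1r.
split; first by rewrite -intA; apply: ge0_subset_integral => // u [].
rewrite -{1}(setUIDK D A) ge0_integral_setU //; last first.
  by rewrite disj_set2E; apply/eqP/seteqP; split=> // u [[_ +] [_]].
rewrite intA leeD2l //.
apply: (@le_trans _ _ (\int[P]_(u in D `\` A) cst (e * (F ^+ (r ^ n))`_l)%:E u)%E).
  apply: ae_ge0_le_integral => //; first by move=> u _; rewrite lee_fin mulr_ge0.
  (* The pointwise bound can fail only for sizes below r^n, which have probability 0. *)
  pose N k := if (k < r ^ n)%N then unmarked_size n k else set0.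
  apply: (@negligibleS _ _ _ _ (\bigcup_k N k)); last first.
    apply: negligible_bigcup => k; rewrite /N; case: ifPn => kr; last exact: negligible_set0.
    by apply/negligibleP; [exact: unmarked_size_measurable|exact: prob_unmarked_size_lt].
  move=> u /= /not_implyP[[Du nA] /negP H].
  have [M|M] := eqVneq (mark_count n u) 0%N; last first.
    by case: H; rewrite lee_fin /unmarked_gf (negbTE M) mul0r mulr_ge0.
  have [Z|Z|Z] := ltngtP (generation_size n u) (r ^ n)%N.
  - by exists (generation_size n u) => //; rewrite /N Z /unmarked_size /= M !eqxx.
  - by case: H; rewrite lee_fin /unmarked_gf M mul1r Fe.
  - by case: nA; rewrite /A /unmarked_size /= M Z !eqxx.
rewrite integral_cst // -[leRHS]mule1 lee_wpmul2l ?lee_fin ?mulr_ge0 //.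
exact: probability_le1.
Qed.

End law_of_unmarked_generation.

(** Dividing by [w], which need not converge, squeezes the ratio between x/(c + e) and (x + e)/c. *)
Lemma cvg_ratio (R : realType) (N D w e : nat -> R) (x c : R) :
  0 <= x -> 0 < c -> e m @[m --> \oo] --> 0 ->
  (\forall m \near \oo, [/\ 0 < w m, 0 <= e m,
     w m * x <= N m <= w m * x + e m * w m & w m * c <= D m <= w m * c + e m * w m]) ->
  N m / D m @[m --> \oo] --> x / c.
Proof.
move=> x0 c0 e0 H.
apply: (squeeze_cvgr (f := fun m => x / (c + e m)) (h := fun m => (x + e m) / c)).
- near=> m.
  have [w0 em /andP[N1 N2] /andP[D1 D2]] : [/\ 0 < w m, 0 <= e m,
     w m * x <= N m <= w m * x + e m * w m & w m * c <= D m <= w m * c + e m * w m].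
    by near: m.
  have wc0 : 0 < w m * c by exact: mulr_gt0.
  have D0 : 0 < D m by exact: lt_le_trans D1.
  have ce0 : 0 < c + e m by rewrite ltr_wpDr.
  rewrite ler_pdivlMr // mulrAC ler_pdivrMr // ler_pdivrMr // mulrAC ler_pdivlMr //.
  apply/andP; split.
    rewrite -(ler_pM2l w0) mulrA (le_trans (ler_wpM2l _ D2)) ?mulr_ge0 ?(ltW w0) //.
    have -> : w m * x * (w m * c + e m * w m) = w m * x * (w m * (c + e m)) by ring.
    have -> : w m * (N m * (c + e m)) = N m * (w m * (c + e m)) by ring.
    by rewrite ler_wpM2r // ltW // mulr_gt0.
  rewrite -(ler_pM2l w0).
  have -> : w m * (N m * c) = N m * (w m * c) by ring.
  have -> : w m * ((x + e m) * D m) = (w m * x + e m * w m) * D m by ring.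
  by apply: ler_pM => //; [apply: le_trans N1; rewrite mulr_ge0 // ltW|exact: ltW].
- rewrite -[X in _ --> x / X](addr0 c); apply: cvgM; first exact: cvg_cst.
  apply: cvgV; first by rewrite addr0 gt_eqF.
  by apply: cvgD => //; exact: cvg_cst.
- rewrite -[X in _ --> X / c](addr0 x); apply: cvgM; last exact: cvg_cst.
  by apply: cvgD => //; exact: cvg_cst.
Unshelve. all: by end_near.
Qed.

(** * Convergence of the penalized ratio *)

Section limit.
Context {R : realType} (l : nat) (p q : nat -> R) (P : probability tree_space R)
  (r : nat) (t s : R).
Hypothesis l_gt0 : (0 < l)%N.
Hypothesis p_ge0 : forall k, 0 <= p k.
Hypothesis q01 : mark_function q.
Hypothesis hP : marked_GW p q P.

Local Notation a := (fun k => p0 p q k false).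

Hypothesis a_sum : (\sum_(0 <= k <oo) (a k)%:E)%E = s%:E.
Hypothesis s_lt1 : s < 1.
Hypothesis r_gt0 : (0 < r)%N.
Hypothesis ar_gt0 : 0 < a r.
Hypothesis a_lt : forall k, (k < r)%N -> a k = 0.
Hypothesis a_moment : (\sum_(0 <= k <oo) (k%:R ^+ l * a k)%:E < +oo)%E.
Hypothesis nondegenerate :
  [\/ l = 1%N, (1 < r)%N | exists2 k : nat, (2 <= k)%N & 0 < a k].
Hypothesis t_gt0 : 0 < t.
Hypothesis t_le1 : t <= 1.

Lemma penalized_ratio_cvg n (D : set tree_space) : tree_filtration n D ->
  (fun m : nat =>
     ('E_P[(fun u => \1_D u * penalization l t (n + m) u)%R]
      / 'E_P[penalization l t (n + m)%N])%E) @ \oo -->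
  ((p0 p q r false ^- (\sum_(i < n) r ^ i))%:E * P (D `&` unmarked_size n (r ^ n)))%E.
Proof.
move=> Dn; have a_ge0 := p0_false_ge0 p_ge0 q01.
have T_n : tree_filtration n [set: tree_space] by apply/tree_filtrationP.
pose f := pen_poly a t l.
have f0 m : f m \is a nneg_poly := pen_poly_nneg l a_ge0 t_gt0 m.
have fL m : gf_summable a l (f m).
  exact: (pen_poly_summable a_ge0 a_sum s_lt1 r_gt0 ar_gt0 a_lt a_moment t_gt0 t_le1 m).
have [C [m0 [C0 dom]]] := pen_poly_dominated a_ge0 a_sum s_lt1 r_gt0 ar_gt0 a_lt
  a_moment t_gt0 t_le1 l_gt0 nondegenerate n.
have s0 : 0 < s := s_gt0 a_ge0 a_sum ar_gt0.
have expE B m : tree_filtration n B ->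
    ('E_P[(fun u => \1_B u * penalization l t (n + m) u)%R] =
     \int[P]_(u in B) (unmarked_gf n (f m) l u)%:E)%E.
  move=> Bn; rewrite expectation_indic.
  under eq_integral do rewrite penalizationE.
  exact: (markov p_ge0 q01 hP m Bn (f0 0%N) fL (leqnn l)).
pose A := unmarked_size n (r ^ n).
(* The index is shifted by one because the geometric decay is stated from [f 1] on. *)
pose I B m : \bar R := (\int[P]_(u in B) (unmarked_gf n (f m.+1) l u)%:E)%E.
pose w m := (f m.+1 ^+ (r ^ n))`_l.
pose c : R := p0 p q r false ^+ (\sum_(i < n) r ^ i).
have c0 : 0 < c by exact: exprn_gt0.
have PA : P A = c%:E.
  exact: (prob_unmarked_size_min p_ge0 q01 hP a_sum (ltW s0) (ltW s_lt1) r_gt0 a_lt).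
have mA : measurable A := unmarked_size_measurable n (r ^ n).
have mD : measurable D.
  by apply: (@tree_determined_measurable n); apply/tree_filtrationP.
have PDA : P (D `&` A) = (fine (P (D `&` A)))%:E.
  by rewrite fineK // fin_num_measure //; exact: measurableI.
have bound B m : tree_filtration n B -> (m0 <= m)%N ->
    (((w m)%:E * P (B `&` A) <= I B m)%E /\
     (I B m <= (w m)%:E * P (B `&` A) + (C * s ^+ m * w m)%:E)%E).
  move=> Bn /dom[_ Hd].
  apply: (unmarked_gf_bounds p_ge0 q01 hP a_sum (ltW s0) (ltW s_lt1) r_gt0 a_lt
    Bn (f0 m.+1) _ Hd).
  by rewrite mulr_ge0 ?exprn_ge0 // ltW.
have Ifin B m : tree_filtration n B -> (m0 <= m)%N -> P (B `&` A) \is a fin_num ->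
    I B m \is a fin_num.
  move=> Bn m0m /fineK PB; have [_ up] := bound B m Bn m0m.
  rewrite ge0_fin_numE; last first.
    by apply: integral_ge0 => u _; rewrite lee_fin unmarked_gf_ge0.
  by apply: le_lt_trans up _; rewrite -PB -EFinM -EFinD ltry.
rewrite -cvg_shiftS.
have -> : ((p0 p q r false ^- (\sum_(i < n) r ^ i))%:E * P (D `&` A) =
    (fine (P (D `&` A)) / c)%:E)%E.
  by rewrite PDA -EFinM mulrC.
have ratioE m : (m0 <= m)%N ->
    ('E_P[(fun u => \1_D u * penalization l t (n + m.+1) u)%R]
      / 'E_P[penalization l t (n + m.+1)%N])%E =
    (fine (I D m) / fine (I setT m))%:E /\
    [/\ 0 < w m, 0 <= C * s ^+ m,
      w m * fine (P (D `&` A)) <= fine (I D m)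
        <= w m * fine (P (D `&` A)) + C * s ^+ m * w m &
      w m * c <= fine (I setT m) <= w m * c + C * s ^+ m * w m].
  move=> m0m; have [w0 _] := dom m m0m.
  have PT : P (setT `&` A) = c%:E by rewrite setTI.
  have ID : (fine (I D m))%:E = I D m by rewrite fineK // Ifin // PDA.
  have IT : (fine (I setT m))%:E = I setT m by rewrite fineK // Ifin // PT.
  have [] := bound D m Dn m0m; rewrite PDA -ID -EFinM -EFinD !lee_fin => D1 D2.
  have [] := bound setT m T_n m0m; rewrite PT -IT -EFinM -EFinD !lee_fin => T1 T2.
  split; last by rewrite D1 D2 T1 T2 w0 mulr_ge0 ?exprn_ge0 ?(ltW C0) ?(ltW s0).
  rewrite (expE D) // -/(I D m).
  have -> : ('E_P[penalization l t (n + m.+1)%N] = I setT m)%E.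
    apply: etrans (expE setT m.+1 T_n); congr (expectation P _); apply/funext => u.
    by rewrite indicE in_setT mul1r.
  (* The extended inverse is the real one because the denominator is positive. *)
  rewrite -ID -IT inver gt_eqF ?EFinM //.
  by apply: lt_le_trans T1; rewrite mulr_gt0.
apply: (@cvg_trans _ ((fine (I D m) / fine (I setT m))%:E @[m --> \oo])).
  apply: near_eq_cvg; near=> m; symmetry; apply: (proj1 (ratioE m _)).
  by near: m; exists m0.
apply: cvg_EFin; first by near=> m.
apply: (@cvg_ratio _ _ _ w (fun m => C * s ^+ m)) => //.
- by rewrite fine_ge0.
- rewrite -[X in _ --> X](mulr0 C); apply: cvgMr.
  by apply: cvg_expr; rewrite ger0_norm // ltW.
- by exists m0 => // m /= /ratioE[].
Unshelve. all: by end_near.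
Qed.

End limit.

(** * Reduction of the theorem to the convergence of the ratio *)

Theorem theorem4p6 (R : realType) (l : nat) (p q : nat -> R)
  (P : probability tree_space R) (r : nat) (t : R)
  (hl : (1 <= l)%N)
  (hp : offspring_distribution p)
  (hp01 : p 0%N + p 1%N < 1)
  (hmean : finite_moment 1 p)
  (hmom : finite_moment l p)
  (hq : mark_function q)
  (hpq : exists k : nat, 0 < p k * q k)
  (hP : marked_GW p q P)
  (* r is the minimum of {j | 0 < p j * (1 - q j)} *)
  (hr : 0 < p r * (1 - q r))
  (hrmin : forall j : nat, 0 < p j * (1 - q j) -> (r <= j)%N)
  (hr1 : (1 <= r)%N)
  (* when this fails, both expectations in the ratio vanish for all indices *)
  (hdef : [\/ l = 1%N, (1 < r)%N | exists2 k : nat, (2 <= k)%N & 0 < p0 p q k false])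
  (ht : 0 < t <= 1) :
  forall (n : nat) (Lambda : set tree_space), tree_filtration n Lambda ->
    (fun m : nat =>
       ('E_P[(fun s => \1_Lambda s * penalization l t (n + m) s)%R]
        / 'E_P[penalization l t (n + m)%N])%E) @ \oo -->
    (if r == 1%N then
       'E_P[(fun s => \1_Lambda s * (p0 p q 1 false) ^- n
          * ((mark_count n s == 0%N) && (generation_size n s == 1%N))%:R)%R]
     else
       'E_P[(fun s => \1_Lambda s * (p0 p q r false) ^- ((r ^ n - 1) %/ (r - 1))
          * ((mark_count n s == 0%N) && (generation_size n s == r ^ n)%N)%:R)%R])%E.
Proof.
move=> n D Dn; have [p_ge0 p_sum] := hp; have /andP[t0 t1] := ht.
pose a k := p0 p q k false.
have a_ge0 k : 0 <= a k by exact: p0_false_ge0.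
have b_ge0 k : 0 <= p k * q k by rewrite mulr_ge0 //; have /andP[] := hq k.
have ab_sum : (\sum_(0 <= k <oo) (a k)%:E + \sum_(0 <= k <oo) (p k * q k)%:E = 1)%E.
  rewrite -p_sum -nneseriesD; do ?by move=> k _ _; rewrite lee_fin.
  by apply: eq_eseriesr => k _; rewrite -EFinD /a /p0; congr EFin; ring.
have b_gt0 : (0 < \sum_(0 <= k <oo) (p k * q k)%:E)%E.
  have [k pqk] := hpq; rewrite (@nneseriesD1 _ _ k) //; last by move=> i _; rewrite lee_fin.
  apply: (@lt_le_trans _ _ (p k * q k)%:E); first by rewrite lte_fin.
  by rewrite leeDl //; apply: nneseries_ge0 => i _ _; rewrite lee_fin.
have a_sum0 : (0 <= \sum_(0 <= k <oo) (a k)%:E)%E.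
  by apply: nneseries_ge0 => i _ _; rewrite lee_fin.
(* The unmarked and marked masses sum to 1, and the marked mass is positive by [hpq]. *)
have [s a_sum s1] : exists2 s, (\sum_(0 <= k <oo) (a k)%:E)%E = s%:E & s < 1.
  move: ab_sum b_gt0 a_sum0; case: (\sum_(0 <= k <oo) (a k)%:E)%E => [s| |] //.
    case: (\sum_(0 <= k <oo) (p k * q k)%:E)%E => [b| |] //.
    rewrite -EFinD => -[<-]; rewrite lte_fin => b0 _; exists s => //.
    by rewrite ltrDl.
  by case: (\sum_(0 <= k <oo) (p k * q k)%:E)%E.
have a_lt k : (k < r)%N -> a k = 0.
  move=> kr; apply/eqP; rewrite eq_le a_ge0 andbT leNgt.
  by apply: contraL kr => /hrmin; rewrite leqNgt.
have a_mom : (\sum_(0 <= k <oo) (k%:R ^+ l * a k)%:E < +oo)%E.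
  apply: le_lt_trans hmom; apply: lee_nneseries => k _.
    by move=> _; rewrite lee_fin mulr_ge0 ?exprn_ge0.
  rewrite lee_fin ler_wpM2l ?exprn_ge0 // /a /p0 ler_piMr //.
  by rewrite lerBlDr lerDl; have /andP[] := hq k.
(* Geometric sum; the division is exact for r > 1, and r = 1 is separate since r - 1 vanishes. *)
have key : (\sum_(i < n) r ^ i)%N = if r == 1%N then n else ((r ^ n - 1) %/ (r - 1))%N.
  have [->|r1] := eqVneq r 1%N.
    by under eq_bigr do rewrite exp1n; rewrite sum_nat_const card_ord muln1.
  rewrite !subn1 predn_exp mulKn // -subn1 subn_gt0 ltn_neqAle eq_sym r1 //.
have target (c : R) :
    ('E_P[(fun s => \1_D s * c * ((mark_count n s == 0%N)
        && (generation_size n s == r ^ n)%N)%:R)%R] = c%:E * P (D `&` unmarked_size n (r ^ n)))%E.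
  have mA := unmarked_size_measurable n (r ^ n).
  have mD : measurable D.
    by apply: (@tree_determined_measurable n); apply/tree_filtrationP.
  rewrite -(@integral_eqr _ P _ (fun u => c%:E)) //; last exact: measurableI.
  under [X in expectation P X]eq_fun do rewrite -mulrA.
  rewrite expectation_indic.
  rewrite [LHS]integral_mkcond [RHS]integral_mkcond; apply: eq_integral => u _.
  rewrite /patch in_setI; case: (u \in D) => //=.
  have -> : (u \in unmarked_size n (r ^ n)) =
      (mark_count n u == 0%N) && (generation_size n u == r ^ n)%N.
    by apply/idP/idP; rewrite inE.
  by case: ifP => _; rewrite ?mulr1 ?mulr0.
have := penalized_ratio_cvg hl p_ge0 hq hP a_sum s1 hr1 hr a_lt a_mom hdef t0 t1 Dn.
rewrite key -target; case: ifP => // /eqP ->.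
by rewrite exp1n.
Qed.
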